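(* Let $G=(V,E)$ be a locally finite weighted graph satisfying the $CD\psi(n,-K)$ condition with $K\geq0$, where $\psi\in C^1(0,+\infty)$ is a concave function with $\psi'(1)>0$, $H_\psi<\infty$ and $\limsup_{\lambda\downarrow0}\frac{\eta_\psi(\lambda)}{\lambda^2}<\infty$. Then there exist positive constants $c,C$ depending only on $n,\psi,D_\mu,\mu_{\max},w_{\min}$ such that for any $x\in V$ and any $r>0$, $$V(x,2r)\leq Ce^{cKr^2}V(x,r).$$
   Context: A locally finite weighted graph $G=(V,E)$ here means a connected graph in which every vertex has finitely many neighbours, with a vertex measure $\mu:V\to(0,\infty)$ and symmetric edge weights $w_{xy}=w_{yx}>0$ for $x\sim y$ (adjacent), such that $D_\mu:=\sup_{x}\frac{\deg(x)}{\mu(x)}<\infty$ where $\deg(x)=\sum_{y\sim x}w_{xy}$, $\mu_{\max}:=\sup_x\mu(x)<\infty$, and $w_{\min}:=\inf_{x\sim y}w_{xy}>0$. $d(x,y)$ is the combinatorial graph distance (minimal number of edges in a path), $B(x,r)=\{y\in V: d(x,y)<r\}$, and $V(x,r)=\sum_{y\in B(x,r)}\mu(y)$. For $f:V\to\mathbb R$, $\Delta f(x)=\frac1{\mu(x)}\sum_{y\sim x}w_{xy}(f(y)-f(x))$. For $\psi\in C^1(0,\infty)$ and $f:V\to(0,\infty)$: $(\Delta^\psi f)(x)=\Delta\left[\psi\left(\frac{f}{f(x)}\right)\right](x)$. For concave $\psi$ put $\overline\psi(s)=\psi'(1)(s-1)-[\psi(s)-\psi(1)]$ and $\Gamma^\psi(f):=\Delta^{\overline\psi}f$,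 i.e. $\Gamma^\psi(f)(x)=\frac1{\mu(x)}\sum_{y\sim x}w_{xy}\overline\psi\left(\frac{f(y)}{f(x)}\right)$. Further $$\Omega^\psi f(x)=\Delta\left[\psi'\left(\frac f{f(x)}\right)\frac f{f(x)}\left(\frac{\Delta f}{f}-\frac{\Delta f(x)}{f(x)}\right)\right](x),$$ $$2\Gamma_2^\psi(f)=\Omega^\psi(f)+\frac{\Delta f\cdot\Delta^\psi f}{f}-\frac{\Delta(f\cdot\Delta^\psi f)}{f}.$$ For $n>0$ and $\kappa\in\mathbb R$, $G$ satisfies $CD\psi(n,\kappa)$ if for every $f:V\to(0,\infty)$, pointwise on $V$, $\Gamma_2^\psi(f)\ge\frac1n(\Delta^\psi f)^2+\kappa\,\Gamma^\psi(f)$. Constants of $\psi$: $H_\psi:=\sup_{s>1}\frac{(\log s)^2}{\overline\psi(s)}$ and, for $\lambda\ge0$, $\eta_\psi(\lambda):=\max\{\overline\psi(e^{\lambda}),\overline\psi(e^{-\lambda})\}$. *)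

(* Defs.v *)
From mathcomp Require Export all_boot all_order all_algebra.
From mathcomp Require Export all_classical all_reals all_analysis.

Set Implicit Arguments.
Unset Strict Implicit.
Unset Printing Implicit Defensive.

Import Order.TTheory GRing.Theory Num.Theory numFieldNormedType.Exports.

Local Open Scope classical_set_scope.
Local Open Scope ring_scope.

(* Loops are not excluded. Values of [weight] at non-adjacent pairs are never
   used. *)
Record weighted_graph (R : realType) := WeightedGraph {
  vertex :> choiceType;
  adj : rel vertex;
  mu : vertex -> R;
  weight : vertex -> vertex -> R;
  adj_sym : symmetric adj;
  adj_connected :
    forall x y, exists p : seq vertex, path adj x p /\ last x p = y;
  adj_locally_finite : forall x, finite_set [set y | adj x y];
  mu_gt0 : forall x, 0 < mu x;
  weight_sym : forall x y, adj x y -> weight x y = weight y x;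
  weight_gt0 : forall x y, adj x y -> 0 < weight x y
}.

Arguments adj {R w}.
Arguments mu {R w}.
Arguments weight {R w}.
Arguments adj_connected {R w}.

Section Graph.
Variables (R : realType) (G : weighted_graph R).
Implicit Types (x y : G) (f : G -> R) (psi : R -> R).

Definition deg x : R := \sum_(y \in [set y | adj x y]) weight x y.

Definition D_mu : \bar R :=
  ereal_sup [set (deg x / mu x)%:E | x in [set: G]].

Definition mu_max : \bar R := ereal_sup [set (mu x)%:E | x in [set: G]].

(* Equal to +oo when there is no edge, i.e. for a one-vertex graph. *)
Definition w_min : \bar R :=
  ereal_inf [set (weight e.1 e.2)%:E | e in [set e : G * G | adj e.1 e.2]].

Lemma ex_path_size x y :
  exists k, `[< exists p, [/\ path adj x p, last x p = y & size p = k] >].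
Proof.
by have [p [xp px]] := adj_connected x y; exists (size p); apply/asboolP; exists p.
Qed.

Definition graph_dist x y : nat := ex_minn (ex_path_size x y).

Definition graph_ball x (r : R) : set G := [set y | (graph_dist x y)%:R < r].

(* Balls are finite, since [G] is connected and locally finite, so the finitely
   supported sum is the true volume. *)
Definition volume x (r : R) : R := \sum_(y \in graph_ball x r) mu y.

Definition laplacian f x : R :=
  (mu x)^-1 * \sum_(y \in [set y | adj x y]) weight x y * (f y - f x).

Definition psi_laplacian psi f x : R := laplacian (fun y => psi (f y / f x)) x.

End Graph.

Section Psi.
Variable R : realType.
Implicit Type psi : R -> R.

Definition C1_pos psi : Prop :=
  forall s, 0 < s -> derivable psi s 1 /\ {for s, continuous (derive1 psi)}.

Definition concave_pos psi : Prop :=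
  convex_function [set s : R^o | 0 < s] (fun s : R^o => - psi s : R^o).

Definition psi_bar psi (s : R) : R :=
  derive1 psi 1 * (s - 1) - (psi s - psi 1).

(* The quotient is taken in [\bar R], where [x / 0 = +oo] for [0 < x]: thus
   [H_psi psi < +oo] forces [psi_bar psi] not to vanish on ]1, +oo[. *)
Definition H_psi psi : \bar R :=
  ereal_sup [set ((ln s ^+ 2)%:E / (psi_bar psi s)%:E)%E | s in [set s | 1 < s]].

Definition eta_psi psi (l : R) : R :=
  Num.max (psi_bar psi (expR l)) (psi_bar psi (expR (- l))).

End Psi.

Section CurvatureDimension.
Variables (R : realType) (G : weighted_graph R) (psi : R -> R).
Implicit Types (x y : G) (f : G -> R).

Definition Gamma_psi f x : R := psi_laplacian (psi_bar psi) f x.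

Definition Omega_psi f x : R :=
  laplacian (fun y => derive1 psi (f y / f x) * (f y / f x) *
    (laplacian f y / f y - laplacian f x / f x)) x.

Definition Gamma2_psi f x : R :=
  2^-1 * (Omega_psi f x + laplacian f x * psi_laplacian psi f x / f x
    - laplacian (fun y => f y * psi_laplacian psi f y) x / f x).

Definition CDpsi (n kappa : R) : Prop :=
  forall f, (forall x, 0 < f x) -> forall x,
    n^-1 * psi_laplacian psi f x ^+ 2 + kappa * Gamma_psi f x
      <= Gamma2_psi f x.

End CurvatureDimension.

(* Main.v *)
Require Import Defs.
From mathcomp Require Import ring lra.
Set Implicit Arguments.
Unset Strict Implicit.
Unset Printing Implicit Defensive.
Import Order.TTheory GRing.Theory Num.Theory numFieldNormedType.Exports.
Local Open Scope classical_set_scope.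
Local Open Scope ring_scope.

(* Write [p = psi'(1)], and let [u = P_t f] solve the heat equation. Then
   [u Gamma = p Delta u - u Delta^psi u] satisfies
     (d/dt - Delta) (u Gamma) = - 2 u Gamma_2
       <= 2 K u Gamma - (2/n) u (Delta^psi u)^2,
   and the square, bounded below by its tangents, leaves an inequality that is
   linear in [u Gamma], [Delta u] and [u]. The maximum principle then gives
   two estimates, depending on the choice of the time-dependent multipliers.
   1. A Li-Yau inequality, which with [(ln s)^2 <= H psi_bar s] integrates along
      paths to a parabolic Harnack inequality.
   2. For [f = exp (- d(x, .) / r)], for which [Gamma f = O(r^-2)] by the
      hypothesis on [eta_psi], a bound [- Delta u / u = O(1 / (r sqrt t))]. Hence
      [P_t 1_B(x,r) (x)] is bounded below at a time [t] comparable to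
      [r^2 / (1 + K r^2)^2].
   By Harnack, [P_T 1_B(x,r)] at the time [T = t + r^2] is at least
   [exp (- C (1 + K r^2))] on [B(x,2r)], while its total mass is at most
   [V(x,r)]. *)

(** * Calculus and the function psi *)

Section Calculus.
Variable R : realType.
Implicit Types (f g df : R -> R) (a b t : R).

Lemma is_derive_cstf (c t : R) : is_derive t (1 : R) (fun=> c) 0.
Proof. exact: (is_derive_cst c t 1). Qed.

Lemma is_derive_addf f g t (df dg : R) :
  is_derive t (1 : R) f df -> is_derive t (1 : R) g dg ->
  is_derive t (1 : R) (fun s => f s + g s) (df + dg).
Proof. exact: is_deriveD. Qed.

Lemma is_derive_subf f g t (df dg : R) :
  is_derive t (1 : R) f df -> is_derive t (1 : R) g dg ->
  is_derive t (1 : R) (fun s => f s - g s) (df - dg).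
Proof. exact: is_deriveB. Qed.

Lemma is_derive_mulf f g t (df dg : R) :
  is_derive t (1 : R) f df -> is_derive t (1 : R) g dg ->
  is_derive t (1 : R) (fun s => f s * g s) (df * g t + f t * dg).
Proof.
move=> hf hg; apply: (is_derive_eq (is_deriveM hf hg)).
by rewrite /GRing.scale /= addrC mulrC.
Qed.

Lemma is_derive_sumf (I : Type) (r : seq I) (F : I -> R -> R) (dF : I -> R) t :
  (forall i, is_derive t (1 : R) (F i) (dF i)) ->
  is_derive t (1 : R) (fun s => \sum_(i <- r) F i s) (\sum_(i <- r) dF i).
Proof.
move=> h; elim: r => [|i r ih].
  rewrite big_nil (_ : (fun s => _) = cst 0); first exact: is_derive_cst.
  by apply/funext => s; rewrite big_nil.
rewrite big_cons (_ : (fun s => _) = fun s => F i s + \sum_(j <- r) F j s).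
  exact: is_derive_addf.
by apply/funext => s; rewrite big_cons.
Qed.

Lemma is_derive_compf f g t (df dg : R) :
  is_derive t (1 : R) g dg -> is_derive (g t) (1 : R) f df ->
  is_derive t (1 : R) (fun s => f (g s)) (df * dg).
Proof.
move=> hg hf; apply: (is_derive_eq (is_derive1_comp hf hg)).
by rewrite /GRing.scale.
Qed.

Lemma le_of_is_derive_le0 f df a b : a <= b ->
  (forall t, a <= t <= b -> is_derive t (1 : R) f (df t)) ->
  (forall t, a <= t <= b -> df t <= 0) -> f b <= f a.
Proof.
move=> ab fd df0.
have cf : {within `[a, b], continuous f}.
  apply: derivable_within_continuous => t; rewrite in_itv/= => tab.
  by have [] := fd t tab.
have [t|c] := MVT_segment ab _ cf (df := df).
  by rewrite in_itv/= => /andP[at_ tb]; apply: fd; rewrite !ltW.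
rewrite in_itv/= => cab fba; rewrite -subr_le0 fba mulr_le0_ge0 ?subr_ge0//.
exact: df0.
Qed.

Lemma le_of_is_derive_ge0 f df a b : a <= b ->
  (forall t, a <= t <= b -> is_derive t (1 : R) f (df t)) ->
  (forall t, a <= t <= b -> 0 <= df t) -> f a <= f b.
Proof.
move=> ab fd df0; rewrite -lerN2.
apply: (@le_of_is_derive_le0 (fun s => - f s) (fun s => - df s)) => // t tab.
  by apply: is_deriveN; exact: fd.
by rewrite oppr_le0 df0.
Qed.

Lemma derivable_bounded f df (T : R) : 0 <= T ->
  (forall t : R, 0 <= t <= T -> is_derive t (1 : R) f (df t)) ->
  exists2 N : R, 0 <= N & forall t : R, 0 <= t <= T -> `|f t| <= N.
Proof.
move=> T0 fd.
have cf : {within `[0, T], continuous f}.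
  apply: derivable_within_continuous => t; rewrite in_itv/= => tab.
  by have [] := fd t tab.
have [c _ fc] := EVT_max T0 cf; have [d _ fd'] := EVT_min T0 cf.
exists (`|f c| + `|f d|) => [|t tT]; first by rewrite addr_ge0.
have tI : t \in `[0, T]%R by rewrite in_itv.
have h1 := fc t tI; have h2 := fd' t tI.
have h3 := ler_norm (f c); have h4 := ler_norm (- f d); rewrite normrN in h4.
have h5 := normr_ge0 (f c); have h6 := normr_ge0 (f d).
by rewrite ler_norml; apply/andP; split; lra.
Qed.

Lemma le0_of_le_geometric (a b : R) : (forall k, a <= b * 3^-1 ^+ k) -> a <= 0.
Proof.
move=> ab; have /cvgr_to_ge : geometric b (3^-1 : R) @ \oo --> (0 : R).
  by apply: cvg_geometric; rewrite ger0_norm ?invr_ge0// invf_lt1 ?ltr1n.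
by apply; apply: nearW => k; exact: ab.
Qed.

Lemma is_derive_monomial (c t : R) k :
  is_derive t (1 : R) (fun s => c * s ^+ k) (c * (k%:R * t ^+ k.-1)).
Proof.
have dX : is_derive t (1 : R) (fun s => s ^+ k) (k%:R * t ^+ k.-1).
  elim: k => [|k ih].
    rewrite mul0r (_ : (fun s => _) = fun=> 1); first exact: is_derive_cstf.
    by apply/funext => s; rewrite expr0.
  rewrite (_ : (fun s => _) = fun s => s * s ^+ k); last first.
    by apply/funext => s; rewrite exprS.
  apply: (is_derive_eq (is_derive_mulf (is_derive_id t (1 : R)) ih)).
  case: k {ih} => [|k]; first by rewrite !mul0r mulr0 addr0.
  by rewrite /= -[k.+2]addn1 natrD exprS; ring.
apply: (is_derive_eq (is_derive_mulf (is_derive_cstf c t) dX)).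
by rewrite mul0r add0r.
Qed.

(* If [a t - b T] were too large, then [c := a t - b] would satisfy the Riccati
   inequality [c' <= - kappa * c ^ 2] on [[t, T]]. *)
Lemma riccati_le (a b da db : R -> R) (t T kappa : R) : t < T -> 0 < kappa ->
  (forall s : R, t <= s <= T -> is_derive s (1 : R) a (da s)) ->
  (forall s : R, t <= s <= T -> is_derive s (1 : R) b (db s)) ->
  (forall s : R, t <= s <= T -> 0 <= da s) ->
  (forall s : R, t <= s <= T -> 0 <= db s) ->
  (forall s : R, t <= s <= T -> b s < a s -> kappa * (a s - b s) ^+ 2 <= db s) ->
  a t <= b T + (kappa * (T - t))^-1.
Proof.
move=> tT k0 dA dB da0 db0 dbk; rewrite leNgt; apply/negP => big.
have kT : 0 < kappa * (T - t) by rewrite mulr_gt0// subr_gt0.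
have kT' : 0 < (kappa * (T - t))^-1 by rewrite invr_gt0.
have mono_a (s : R) : t <= s <= T -> a t <= a s.
  move=> /andP[ts sT]; apply: (@le_of_is_derive_ge0 a da t s ts) => v /andP[tv vs].
    by apply: dA; rewrite tv (le_trans vs).
  by apply: da0; rewrite tv (le_trans vs).
have mono_b (s : R) : t <= s <= T -> b s <= b T.
  move=> /andP[ts sT]; apply: (@le_of_is_derive_ge0 b db s T sT) => v /andP[sv vT].
    by apply: dB; rewrite vT (le_trans ts).
  by apply: db0; rewrite vT (le_trans ts).
have c0 (s : R) : t <= s <= T -> 0 < a t - b s by move=> /mono_b; lra.
(* The Riccati inequality makes [1 / c] grow at rate at least [kappa], so [phi] is nondecreasing;
   but [big] puts [1 / c] at time [T] below [kappa * (T - t)], which is too small. *)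
pose phi (s : R) := (a t - b s)^-1 - kappa * s.
have dphi (s : R) : t <= s <= T ->
    is_derive s (1 : R) phi ((a t - b s) ^- 2 * db s - kappa).
  move=> st; have d1 := is_derive_subf (is_derive_cstf (a t) s) (dB s st).
  have dk : is_derive s (1 : R) (fun v => kappa * v) kappa.
    apply: (is_derive_eq (is_derive_mulf (is_derive_cstf kappa s)
      (is_derive_id s (1 : R)))).
    by rewrite mul0r add0r mulr1.
  have d2 : is_derive s (1 : R) (fun v => (a t - b v)^-1) ((a t - b s) ^- 2 * db s).
    apply: (is_derive_eq (is_deriveV _ d1)); first by rewrite gt_eqF// c0.
    by rewrite /GRing.scale/= sub0r mulrNN.
  exact: is_derive_subf d2 dk.
have : phi t <= phi T.
  apply: (@le_of_is_derive_ge0 phi _ t T (ltW tT) dphi) => s st.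
  have cs := c0 s st; have ms := mono_a s st.
  have c2 : 0 < (a t - b s) ^+ 2 by rewrite exprn_gt0.
  rewrite subr_ge0 mulrC ler_pdivlMr//.
  apply: le_trans (dbk s st _); last by lra.
  by rewrite ler_pM2l//; apply: lerXn2r; rewrite ?nnegrE; lra.
rewrite /phi; have ct : 0 < a t - b t by apply: c0; rewrite lexx ltW.
have cT : 0 < a t - b T by apply: c0; rewrite lexx ltW.
have : (a t - b T)^-1 < kappa * (T - t).
  by rewrite invf_plt ?posrE//; lra.
have : 0 < (a t - b t)^-1 by rewrite invr_gt0.
lra.
Qed.

End Calculus.

(** * Bounds on [psi_bar] *)

Section PsiFacts.
Variables (R : realType) (psi : R -> R).
Hypotheses (psi_C1 : C1_pos psi) (psi_concave : concave_pos psi).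
Local Notation bpsi := (psi_bar psi).
Local Notation p := (derive1 psi 1).

Lemma is_derive_psi (s : R) : 0 < s -> is_derive s (1 : R) psi (derive1 psi s).
Proof.
move=> s0; have [d _] := psi_C1 s0.
by apply: DeriveDef => //; rewrite derive1E.
Qed.

Lemma psi_bar1 : bpsi 1 = 0.
Proof. by rewrite /psi_bar !subrr mulr0 subr0. Qed.

Lemma concave_pos_le (s t : R) : 0 < s -> 0 <= t <= 1 ->
  (1 - t) * psi 1 + t * psi s <= psi (1 + t * (s - 1)).
Proof.
move=> s0 /andP[t0 t1].
have H : - psi (t * s + (1 - t) * 1) <= t * - psi s + (1 - t) * - psi 1.
  by apply: (psi_concave (Itv01 t0 t1)); rewrite inE/=.
rewrite (_ : 1 + t * (s - 1) = t * s + (1 - t) * 1); last by ring.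
lra.
Qed.

(** By concavity [phi], the height of the graph of [psi] above its chord from 1 to [s], is
    nonnegative on [[0, 1]]. It vanishes at 0, and its derivative there is [bpsi s]. *)
Lemma psi_bar_ge0 (s : R) : 0 < s -> 0 <= bpsi s.
Proof.
move=> s0; pose phi t := psi (1 + t * (s - 1)) - psi 1 - t * (psi s - psi 1).
have phi0 : phi 0 = 0 by rewrite /phi !mul0r addr0 subrr subr0.
have dphi : is_derive (0 : R) (1 : R) phi (bpsi s).
  have dlin (c : R) : is_derive (0 : R) (1 : R) (fun t => t * c) c.
    apply: (is_derive_eq (is_derive_mulf (is_derive_id _ _)
      (is_derive_cstf c _))).
    by rewrite mul1r mulr0 addr0.
  rewrite /psi_bar; apply: is_derive_subf => //.
  rewrite -[X in is_derive _ _ _ X]subr0; apply: is_derive_subf.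
    have dg : is_derive (0 : R) (1 : R) (fun t => 1 + t * (s - 1)) (s - 1).
      rewrite -[X in is_derive _ _ _ X]add0r.
      by apply: is_derive_addf => //; exact: is_derive_cstf.
    apply: (is_derive_compf dg); rewrite mul0r addr0.
    exact: is_derive_psi.
have [dv <-] := dphi.
have /cvg_dnbhs_at_right/cvgr_to_ge := dv : _ --> _; apply.
near=> h; have h0 : 0 < h by near: h; exact: nbhs_right_gt.
have h1 : h < 1 by near: h; exact: nbhs_right_lt.
rewrite phi0 subr0 /GRing.scale/= mulr_ge0 ?invr_ge0 ?(ltW h0)//.
rewrite /phi addr0 mulr1.
by have := @concave_pos_le s h s0; rewrite (ltW h0) (ltW h1) => /(_ isT); lra.
Unshelve. all: by end_near. Qed.

Lemma psi_bar_bounded (a b : R) : 0 < a -> a <= b ->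
  exists2 B, 0 <= B & forall s, a <= s <= b -> bpsi s <= B.
Proof.
move=> a0 ab.
have cf : {within `[a, b], continuous bpsi}.
  apply: derivable_within_continuous => t; rewrite in_itv/= => /andP[at_ _].
  have t0 := lt_le_trans a0 at_.
  suff: is_derive t (1 : R) bpsi (p - derive1 psi t) by case.
  have d1 : is_derive t (1 : R) (fun s => s - 1) 1.
    apply: (is_derive_eq (is_derive_subf (is_derive_id t 1) (is_derive_cstf 1 t))).
    by rewrite subr0.
  have d2 := is_derive_mulf (is_derive_cstf p t) d1.
  have d3 := is_derive_subf (is_derive_psi t0) (is_derive_cstf (psi 1) t).
  apply: (is_derive_eq (is_derive_subf d2 d3)).
  by rewrite mul0r add0r mulr1 subr0.
have [c cab cB] := EVT_max ab cf.
exists (bpsi c); last by move=> s sab; apply: cB; rewrite in_itv.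
by apply: psi_bar_ge0; move: cab; rewrite in_itv/= => /andP[/(lt_le_trans a0)].
Qed.

Lemma H_psi_bound : (H_psi psi < +oo)%E ->
  exists2 h, 0 < h & forall s, 1 < s -> ln s ^+ 2 <= h * bpsi s.
Proof.
move=> Hfin.
have [h Hh] : exists h : R, (H_psi psi <= h%:E)%E.
  case E : (H_psi psi) Hfin => [h| |]// _; first by exists h.
  by exists 0; exact: leNye.
exists (Num.max 1 h); first by rewrite lt_max ltr01.
move=> s s1; have s0 : 0 < s by lra.
have ln0 : 0 < ln s ^+ 2 by rewrite exprn_gt0// ln_gt0.
have le_h : ((ln s ^+ 2)%:E / (bpsi s)%:E <= h%:E)%E.
  by apply: le_trans Hh; apply: ereal_sup_ubound; exists s.
(* If [bpsi s] vanished, the extended quotient in [le_h] would be [+oo]. *)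
have := psi_bar_ge0 s0; rewrite le_eqVlt => /predU1P[b0|b0].
  move: le_h; rewrite -b0 inve0 gt0_muley ?lte_fin//.
move: le_h; rewrite inver (gt_eqF b0) -EFinM lee_fin ler_pdivrMr// => /le_trans.
by apply; rewrite ler_wpM2r ?(ltW b0)// le_max lexx orbT.
Qed.

(** A limsup is an infimum of suprema over neighbourhoods, so its finiteness already provides one
    right neighbourhood of 0 with a quadratic bound. *)
Lemma eta_psi_bound :
  (limf_esup (fun l : R => (eta_psi psi l / l ^+ 2)%:E) 0^'+ < +oo)%E ->
  exists c l0, [/\ 0 < c, 0 < l0 & forall l, 0 < l -> l < l0 ->
    bpsi (expR l) <= c * l ^+ 2 /\ bpsi (expR (- l)) <= c * l ^+ 2].
Proof.
rewrite limf_esupE => /ereal_inf_lt[_ [V V0 <-]] supV.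
have [c Vc] : exists c : R, forall l, V l -> eta_psi psi l / l ^+ 2 <= c.
  have Vle l : V l -> ((eta_psi psi l / l ^+ 2)%:E <= ereal_sup
      [set (eta_psi psi l / l ^+ 2)%:E | l in V])%E.
    by move=> Vl; apply: ereal_sup_ubound; exists l.
  case: (ereal_sup _) supV Vle => [c| |]// _ Vle.
    by exists c => l /Vle; rewrite lee_fin.
  by exists 0 => l /Vle; rewrite leeNy_eq.
case: V0 => e /= e0 Ve.
exists (Num.max 1 c), e; split=> //; first by rewrite lt_max ltr01.
move=> l l0 le; have l2 : 0 < l ^+ 2 by rewrite exprn_gt0.
have := Vc l (Ve l _ l0); rewrite /= sub0r normrN gtr0_norm// => /(_ le).
rewrite ler_pdivrMr// => etal.
have {}etal : eta_psi psi l <= Num.max 1 c * l ^+ 2.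
  by apply: (le_trans etal); rewrite ler_wpM2r ?(ltW l2)// le_max lexx orbT.
by move: etal; rewrite /eta_psi ge_max => /andP[].
Qed.

End PsiFacts.

(** * The heat semigroup of a bounded Laplacian *)

Section ExponentialSeries.
Variable R : realType.
Implicit Types (c d : nat -> R) (t M : R).

(** Differentiation in [t] shifts [c]; when [c] lists the iterates of an operator, this therefore
    plays the part of the operator exponential. *)
Definition egf c t : R := limn (pseries (fun k => c k / k`!%:R) t).

Definition seq_bounded c := exists M, forall k, `|c k| <= M.

Lemma egf_cvg c t : seq_bounded c -> cvgn (pseries (fun k => c k / k`!%:R) t).
Proof.
move=> [M cM]; apply: normed_cvg; rewrite /normed_series_of /=.
have cvgM : cvgn (series (fun k => M * exp_coeff `|t| k)).
  by apply: (@is_cvg_seriesZ _ _ M); exact: is_cvg_series_exp_coeff.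
have M0 : 0 <= M by apply: le_trans (normr_ge0 _) (cM 0%N).
apply: series_le_cvg cvgM => n /=; first exact: normr_ge0.
  by rewrite mulr_ge0 ?divr_ge0 ?exprn_ge0 ?ler0n.
rewrite /exp_coeff/= !normrM normfV normrX (ger0_norm (ler0n _ _)).
by rewrite -mulrA (mulrC _^-1) ler_wpM2r.
Qed.

Lemma seq_boundedS c : seq_bounded c -> seq_bounded (fun k => c k.+1).
Proof. by move=> [M cM]; exists M. Qed.

Lemma is_derive_egf c t : seq_bounded c ->
  is_derive t (1 : R) (egf c) (egf (fun k => c k.+1) t).
Proof.
move=> bc; have dE d : pseries_diffs (fun k => d k / k`!%:R)
    = (fun k => d k.+1 / k`!%:R).
  apply/funext => k; rewrite /pseries_diffs factS natrM invfM.
  by rewrite mulrCA mulVKf.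
rewrite /egf -dE.
have lt_t : `|t| < `|(`|t| + 1)| by rewrite [ltRHS]ger0_norm ?addr_ge0// ltrDl.
apply: (pseries_snd_diffs _ _ _ lt_t); rewrite ?dE; apply: egf_cvg => //.
- exact: (seq_boundedS bc).
- exact: (seq_boundedS (seq_boundedS bc)).
Qed.

Lemma egf0 c : egf c 0 = c 0%N.
Proof.
rewrite /egf; apply: lim_near_cst => //.
near=> n; rewrite /pseries /series /= -[n]prednK; last by near: n; exists 1%N.
rewrite big_nat_recl//= big1 ?addr0 ?expr0 ?mulr1 ?fact0 ?divr1//.
by move=> i _; rewrite expr0n mulr0.
Unshelve. all: by end_near. Qed.

Lemma egf_lin a c d t : seq_bounded c -> seq_bounded d ->
  egf (fun k => a * c k + d k) t = a * egf c t + egf d t.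
Proof.
move=> bc bd; rewrite /egf; apply/cvg_lim => //.
rewrite (_ : pseries _ t = fun n => a * pseries (fun k => c k / k`!%:R) t n
    + pseries (fun k => d k / k`!%:R) t n).
  apply: cvgD; last exact: egf_cvg.
  by apply: cvgM; [exact: cvg_cst|exact: egf_cvg].
apply/funext => n; rewrite /pseries /series /= mulr_sumr -big_split/=.
by apply: eq_bigr => i _; rewrite mulrDl mulrDl !mulrA.
Qed.

Lemma egf_ext c d t : c =1 d -> egf c t = egf d t.
Proof. by move=> /funext ->. Qed.

Lemma egf_cst a t : egf (fun=> a) t = a * expR t.
Proof.
have b1 : seq_bounded (fun=> 1 : R) by exists 1 => _; rewrite normr1.
have b0 : seq_bounded (fun=> 0 : R) by exists 0 => _; rewrite normr0.
have e1 : egf (fun=> 1) t = expR t.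
  rewrite expRE /egf; congr (limn (pseries _ _)).
  by apply/funext => k; rewrite mul1r.
have e0 : egf (fun=> 0) t = 0.
  by have := egf_lin (-1) t b0 b0; rewrite mulN1r addNr => ->; rewrite mulN1r addNr.
rewrite -e1 -[RHS]addr0 -[X in _ = _ + X]e0 -egf_lin//.
by apply: egf_ext => k; rewrite mulr1 addr0.
Qed.

Lemma seq_bounded_sum (I : Type) (r : seq I) (a : I -> R) (c : I -> nat -> R) :
  (forall i, seq_bounded (c i)) ->
  seq_bounded (fun k => \sum_(i <- r) a i * c i k).
Proof.
move=> bc; elim: r => [|i r [M bM]].
  by exists 0 => k; rewrite big_nil normr0.
have [N bN] := bc i; exists (`|a i| * N + M) => k; rewrite big_cons.
by rewrite (le_trans (ler_normD _ _))// lerD// normrM ler_wpM2l.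
Qed.

Lemma egf_sum (I : Type) (r : seq I) (a : I -> R) (c : I -> nat -> R) t :
  (forall i, seq_bounded (c i)) ->
  egf (fun k => \sum_(i <- r) a i * c i k) t = \sum_(i <- r) a i * egf (c i) t.
Proof.
move=> bc; elim: r => [|i r ih].
  by under egf_ext do rewrite big_nil; rewrite egf_cst mul0r big_nil.
under egf_ext do rewrite big_cons.
by rewrite egf_lin ?big_cons ?ih//; exact: seq_bounded_sum.
Qed.

(** The derivative has the shifted coefficients, which are again nonnegative, so the sum never falls
    below its value at time 0. *)
Lemma egf_ge_head c t : seq_bounded c -> (forall k, 0 <= c k) -> 0 <= t ->
  0 <= egf c t /\ c 0%N <= egf c t.
Proof.
have ge0 d s : seq_bounded d -> (forall k, 0 <= d k) -> 0 <= s -> 0 <= egf d s.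
  move=> bd d0 s0; apply: limr_ge; first exact: egf_cvg.
  near=> n; rewrite /pseries/= /series/=; apply: sumr_ge0 => i _.
  by rewrite !mulr_ge0 ?invr_ge0 ?ler0n ?exprn_ge0.
move=> bc c0 t0; split; first exact: ge0.
rewrite -(egf0 c); apply: (le_of_is_derive_ge0 t0) => s /andP[s0 _].
  exact: is_derive_egf.
exact: (ge0 _ _ (seq_boundedS bc)).
Unshelve. all: by end_near. Qed.

Lemma egf_le c d t : seq_bounded c -> seq_bounded d -> (forall k, c k <= d k) ->
  0 <= t -> egf c t <= egf d t.
Proof.
move=> bc bd cd t0.
have [M cM] := bc; have [N dN] := bd.
have bcd : seq_bounded (fun k => -1 * c k + d k).
  exists (M + N) => k; rewrite mulN1r (le_trans (ler_normD _ _))// normrN.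
  by rewrite lerD.
have cd0 k : 0 <= -1 * c k + d k by rewrite mulN1r addrC subr_ge0.
have [+ _] := egf_ge_head bcd cd0 t0.
by rewrite egf_lin// mulN1r addrC subr_ge0.
Qed.

End ExponentialSeries.

(** * Sums over neighbours and linearity of the Laplacian *)

Section GraphSums.
Variables (R : realType) (G : weighted_graph R).
Implicit Types (x y : G) (f g : G -> R).

Definition neighbors x : seq G := finmap.enum_fset (fset_set [set y | adj x y]).

Lemma neighbors_uniq x : uniq (neighbors x).
Proof. exact: finmap.fset_uniq. Qed.

Lemma in_neighbors x y : (y \in neighbors x) = adj x y.
Proof.
rewrite /neighbors in_fset_set; last exact: adj_locally_finite.
by apply/idP/idP; rewrite inE.
Qed.

Lemma laplacianE f x :
  laplacian f x = (mu x)^-1 * \sum_(y <- neighbors x) weight x y * (f y - f x).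
Proof. by rewrite /laplacian fsbig_finite//; exact: adj_locally_finite. Qed.

Lemma degE x : deg x = \sum_(y <- neighbors x) weight x y.
Proof. by rewrite /deg fsbig_finite//; exact: adj_locally_finite. Qed.

Lemma ler_neighbors x (F H : G -> R) : (forall y, adj x y -> F y <= H y) ->
  \sum_(y <- neighbors x) F y <= \sum_(y <- neighbors x) H y.
Proof.
move=> FH; rewrite big_seq [leRHS]big_seq; apply: ler_sum => y.
by rewrite in_neighbors; exact: FH.
Qed.

Lemma laplacian_lin (a : R) f g x :
  laplacian (fun y => a * f y + g y) x = a * laplacian f x + laplacian g x.
Proof.
rewrite !laplacianE mulrCA -mulrDr; congr (_ * _).
by rewrite mulr_sumr -big_split/=; apply: eq_bigr => y _; ring.
Qed.

Lemma laplacian_cst (a : R) x : laplacian (fun=> a : R) x = 0 :> R.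
Proof. by rewrite laplacianE big1 ?mulr0// => y _; rewrite subrr mulr0. Qed.

Lemma laplacianZ (a : R) f x : laplacian (fun y => a * f y) x = a * laplacian f x.
Proof.
rewrite -[RHS]addr0 -(laplacian_cst 0 x) -laplacian_lin.
by congr (laplacian _ x); apply/funext => y; rewrite addr0.
Qed.

Lemma laplacian_lin3 (a b c : R) f g h x :
  laplacian (fun y => a * f y + (b * g y + c * h y)) x =
  a * laplacian f x + (b * laplacian g x + c * laplacian h x).
Proof. by rewrite laplacian_lin laplacian_lin laplacianZ. Qed.

Lemma laplacian_deg f x : laplacian f x =
  (mu x)^-1 * \sum_(y <- neighbors x) weight x y * f y - deg x / mu x * f x.
Proof.
rewrite laplacianE degE (mulrC (\sum_(y <- _) _)) -mulrA -mulrBr mulr_suml -sumrB.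
by congr (_ * _); apply: eq_bigr => y _; ring.
Qed.

End GraphSums.

(** * The heat semigroup by uniformization *)

Section HeatSemigroup.
Variables (R : realType) (G : weighted_graph R) (D : R).
Hypotheses (D_gt0 : 0 < D) (deg_le : forall x : G, deg x <= D * mu x).
Implicit Types (x y : G) (f g : G -> R) (t : R).

(** By [deg_le] this is an average with nonnegative weights of total 1, hence monotone and
    constant-preserving. *)
Definition markov f x : R := f x + laplacian f x / D.

Lemma markovE f x : markov f x = (1 - deg x / (D * mu x)) * f x +
  \sum_(y <- neighbors x) weight x y / (D * mu x) * f y.
Proof.
have m0 : mu x != 0 by rewrite gt_eqF// mu_gt0.
have d0 : D != 0 by rewrite gt_eqF.
have -> : \sum_(y <- neighbors x) weight x y / (D * mu x) * f y =
    (D * mu x)^-1 * \sum_(y <- neighbors x) weight x y * f y.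
  by rewrite mulr_sumr; apply: eq_bigr => y _; ring.
by rewrite /markov laplacian_deg; field; rewrite m0.
Qed.

Lemma markov_le f g : (forall x, f x <= g x) -> forall x, markov f x <= markov g x.
Proof.
move=> fg x; have m0 := mu_gt0 x; rewrite !markovE; apply: lerD.
  apply: ler_wpM2l => //.
  by rewrite subr_ge0 ler_pdivrMr ?mul1r// mulr_gt0.
apply: ler_neighbors => y xy; apply: ler_wpM2l => //.
by rewrite divr_ge0 ?mulr_ge0 ?ltW// weight_gt0.
Qed.

Lemma markov_lin (a : R) f g x :
  markov (fun y => a * f y + g y) x = a * markov f x + markov g x.
Proof. by rewrite /markov laplacian_lin; ring. Qed.

Lemma markov_cst (a : R) x : markov (fun=> a) x = a.
Proof. by rewrite /markov laplacian_cst mul0r addr0. Qed.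

Definition iter_markov f x k : R := iter k markov f x.

Lemma iter_markov_le f g : (forall x, f x <= g x) ->
  forall x k, iter_markov f x k <= iter_markov g x k.
Proof.
by move=> fg x k; elim: k x => //= k ih x; apply: markov_le => y; exact: ih.
Qed.

Lemma iter_markov_lin (a : R) f g x k : iter_markov (fun y => a * f y + g y) x k =
  a * iter_markov f x k + iter_markov g x k.
Proof.
elim: k x => //= k ih x; rewrite /iter_markov/= -markov_lin.
by congr (markov _ x); apply/funext => y; exact: ih.
Qed.

Lemma iter_markov_cst (a : R) x k : iter_markov (fun=> a) x k = a.
Proof.
elim: k x => //= k ih x; rewrite /iter_markov/= -[RHS](markov_cst a x).
by congr (markov _ x); apply/funext => y; exact: ih.
Qed.

Definition fun_bounded f := exists M, forall x, `|f x| <= M.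

Lemma fun_bounded_lin (a : R) f g : fun_bounded f -> fun_bounded g ->
  fun_bounded (fun y => a * f y + g y).
Proof.
move=> [M fM] [N gN]; exists (`|a| * M + N) => x.
by rewrite (le_trans (ler_normD _ _))// lerD// normrM ler_wpM2l.
Qed.

Lemma fun_bounded_cst (a : R) : fun_bounded (fun=> a).
Proof. by exists `|a|. Qed.

Lemma iter_markov_bounded f : fun_bounded f ->
  forall x, seq_bounded (iter_markov f x).
Proof.
move=> [M fM] x; exists M => k; rewrite ler_norml.
rewrite -{1}(iter_markov_cst (- M) x k) -{2}(iter_markov_cst M x k).
by rewrite !iter_markov_le// => y; have := fM y; rewrite ler_norml => /andP[].
Qed.

(** Uniformization: the Laplacian is [D (P - I)] with [P = markov], so its exponential is
    [exp (- D t)] times the exponential series of [P]. For bounded [f] the series converges at each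
    vertex, and order properties pass from [P] to it. *)
Definition heat f t x : R := expR (- (D * t)) * egf (iter_markov f x) (D * t).

Lemma heat0 f x : heat f 0 x = f x.
Proof. by rewrite /heat mulr0 oppr0 expR0 mul1r egf0. Qed.

Lemma heat_le f g t : fun_bounded f -> fun_bounded g ->
  (forall x, f x <= g x) -> 0 <= t -> forall x, heat f t x <= heat g t x.
Proof.
move=> bf bg fg t0 x; rewrite /heat ler_pM2l ?expR_gt0//.
apply: egf_le; [exact: iter_markov_bounded|exact: iter_markov_bounded| |].
  exact: iter_markov_le.
by rewrite mulr_ge0// ltW.
Qed.

Lemma heat_lin (a : R) f g t x : fun_bounded f -> fun_bounded g ->
  heat (fun y => a * f y + g y) t x = a * heat f t x + heat g t x.
Proof.
move=> bf bg; rewrite /heat.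
rewrite (egf_ext _ (iter_markov_lin a f g x)) egf_lin; last 2 first.
- exact: iter_markov_bounded.
- exact: iter_markov_bounded.
by ring.
Qed.

Lemma heat_cst (a : R) t x : heat (fun=> a) t x = a.
Proof.
rewrite /heat (egf_ext _ (iter_markov_cst a x)) egf_cst mulrCA.
by rewrite -expRD addNr expR0 mulr1.
Qed.

Lemma heat_bounds f a b : (forall x, a <= f x <= b) ->
  forall t x, 0 <= t -> a <= heat f t x <= b.
Proof.
move=> fab t x t0.
have bf : fun_bounded f.
  exists (Num.max (- a) b) => y; have /andP[af fb] := fab y.
  by rewrite ler_norml lerNl !le_max lerN2 af fb orbT.
apply/andP; split.
  rewrite -[leLHS](heat_cst a t x); apply: heat_le => //.
    exact: fun_bounded_cst.
  by move=> y; have /andP[] := fab y.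
rewrite -[leRHS](heat_cst b t x); apply: heat_le => //.
  exact: fun_bounded_cst.
by move=> y; have /andP[] := fab y.
Qed.

Lemma laplacian_heat f t x : fun_bounded f -> laplacian (heat f t) x =
  expR (- (D * t)) * (D * (egf (fun k => iter_markov f x k.+1) (D * t)
    - egf (iter_markov f x) (D * t))).
Proof.
move=> bf; have bm := iter_markov_bounded bf.
have Dn0 : D != 0 by rewrite gt_eqF.
(* The left side is [D * markov D (heat f t) x]. This is a finite sum at [x], so it passes inside
   the series and shifts the iterates by one. *)
have E : D * laplacian (heat f t) x / D + D * heat f t x = D * (expR (- (D * t)) *
    egf (fun k => iter_markov f x k.+1) (D * t)).
  rewrite -mulrA -mulrDr addrC -[heat f t x + _]/(markov (heat f t) x) markovE.
  rewrite (egf_ext _ (fun k => markovE (fun y => iter_markov f y k) x)).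
  rewrite egf_lin//; last exact: seq_bounded_sum.
  rewrite egf_sum//; congr (D * _); rewrite mulrDr mulr_sumr; congr (_ + _).
    by rewrite mulrCA.
  by apply: eq_bigr => y _; rewrite mulrCA.
have {E} : laplacian (heat f t) x = D * (expR (- (D * t)) *
    egf (fun k => iter_markov f x k.+1) (D * t)) - D * heat f t x.
  by rewrite -E mulrAC mulfV// mul1r addrK.
by rewrite /heat => ->; ring.
Qed.

Lemma is_derive_heat f t x : fun_bounded f ->
  is_derive t (1 : R) (fun s => heat f s x) (laplacian (heat f t) x).
Proof.
move=> bf; rewrite laplacian_heat//.
have dD : is_derive t (1 : R) (fun s => D * s) D.
  apply: (is_derive_eq (is_derive_mulf (is_derive_cstf D t) (is_derive_id t 1))).
  by rewrite mul0r add0r mulr1.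
have dN : is_derive t (1 : R) (fun s => - (D * s)) (- D) by exact: is_deriveN.
have d1 := is_derive_compf dN (is_derive_expR (- (D * t))).
have d2 := is_derive_compf dD (is_derive_egf (D * t) (iter_markov_bounded bf x)).
by apply: (is_derive_eq (is_derive_mulf d1 d2)); ring.
Qed.

(** Only the zeroth term of the series is kept, which is enough for bounded times. *)
Lemma heat_ge_exp f t x : fun_bounded f -> (forall y, 0 <= f y) -> 0 <= t ->
  expR (- (D * t)) * f x <= heat f t x.
Proof.
move=> bf f0 t0; rewrite /heat ler_pM2l ?expR_gt0//.
have Dt0 : 0 <= D * t by rewrite mulr_ge0// ltW.
have [|_] := egf_ge_head (iter_markov_bounded bf x) _ Dt0; last by [].
by move=> k; rewrite -(iter_markov_cst 0 x k); exact: iter_markov_le.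
Qed.

(** The total mass is tested on finite lists, so that no sum over all vertices has to converge. *)
Definition mass_le f (m : R) :=
  forall F : seq G, uniq F -> \sum_(y <- F) mu y * f y <= m.

(** By symmetry of the weights, the mass arriving in [F] can be sorted by the vertex [z] it comes
    from; [z] sends at most [deg z * f z / D] and keeps the rest of [mu z * f z]. *)
Lemma markov_mass_le f m : (forall x, 0 <= f x) -> mass_le f m ->
  mass_le (markov f) m.
Proof.
move=> f0 fm F uF.
(* Extending the weights by 0 turns sums over neighbours into sums over any larger list, which can
   then be exchanged. *)
pose wt x y : R := if adj x y then weight x y else 0.
have wt_ge0 x y : 0 <= wt x y by rewrite /wt; case: ifP => // /weight_gt0/ltW.
have wt_sym x y : wt x y = wt y x.
  by rewrite /wt (adj_sym y x); case: ifP => // /weight_sym.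
have sum_wt (A : seq G) x g : uniq A -> {subset neighbors x <= A} ->
    \sum_(y <- neighbors x) weight x y * g y = \sum_(y <- A) wt x y * g y.
  move=> uA sub; rewrite [RHS](bigID (adj x))/= [X in _ = _ + X]big1 ?addr0; last first.
    by move=> y /negbTE xy; rewrite /wt xy mul0r.
  rewrite [RHS](eq_bigr (fun y => weight x y * g y)); last first.
    by move=> y xy; rewrite /wt xy.
  rewrite -[RHS]big_filter; apply: perm_big.
  apply: uniq_perm; [exact: neighbors_uniq|by rewrite filter_uniq|].
  move=> y; rewrite mem_filter in_neighbors; apply/idP/andP => [xy|[]//].
  by split=> //; apply: sub; rewrite in_neighbors.
(* The values of [markov f] on [F] depend on [f] only through [A]. *)
pose A := undup (F ++ flatten [seq neighbors x | x <- F]).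
have uA : uniq A by exact: undup_uniq.
have FA : {subset F <= A} by move=> x xF; rewrite mem_undup mem_cat xF.
have NA x : x \in F -> {subset neighbors x <= A}.
  move=> xF y yx; rewrite mem_undup mem_cat; apply/orP; right.
  by apply/flattenP; exists (neighbors x) => //; exact: map_f.
have sub_le (B : seq G) (H : G -> R) : uniq B -> {subset B <= A} ->
    (forall y, 0 <= H y) -> \sum_(y <- B) H y <= \sum_(y <- A) H y.
  move=> uB BA H0; rewrite [leRHS](bigID (mem B))/=.
  rewrite -[leLHS]addr0; apply: lerD; last exact: sumr_ge0.
  rewrite -[leRHS]big_filter (perm_big [seq y <- A | y \in B])//.
  apply: uniq_perm; rewrite ?filter_uniq// => y; rewrite mem_filter.
  by apply/idP/andP => [yB|[]//]; split=> //; exact: BA.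
have muD x : mu x != 0 by rewrite gt_eqF// mu_gt0.
have Dn0 : D != 0 by rewrite gt_eqF.
have -> : \sum_(y <- F) mu y * markov f y =
    \sum_(y <- F) (mu y - deg y / D) * f y
    + \sum_(z <- A) (\sum_(y <- F) wt z y) * (f z / D).
  under [X in _ = _ + X]eq_bigr do rewrite mulr_suml.
  rewrite exchange_big/= -big_split/= big_seq [RHS]big_seq; apply: eq_bigr => y yF.
  rewrite markovE mulrDr; congr (_ + _).
    by field; rewrite ?muD ?Dn0.
  transitivity (\sum_(z <- neighbors y) weight y z * (f z / D)).
    by rewrite mulr_sumr; apply: eq_bigr => z _; field; rewrite ?muD ?Dn0.
  by rewrite (sum_wt A)//; [under eq_bigr do rewrite wt_sym|exact: NA].
apply: le_trans (fm A uA).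
rewrite [leRHS](_ : _ = \sum_(y <- A) (mu y - deg y / D) * f y
    + \sum_(y <- A) deg y * (f y / D)); last first.
  by rewrite -big_split/=; apply: eq_bigr => y _; field.
apply: lerD.
  apply: sub_le => // y; rewrite mulr_ge0// subr_ge0 ler_pdivrMr// mulrC.
  exact: deg_le.
apply: ler_sum => z _; apply: ler_wpM2r; first by rewrite divr_ge0// ltW.
have -> : deg z = \sum_(y <- neighbors z) weight z y * 1.
  by rewrite degE; apply: eq_bigr => y _; rewrite mulr1.
rewrite (sum_wt (undup (F ++ neighbors z))) ?undup_uniq//; last first.
  by move=> y yz; rewrite mem_undup mem_cat yz orbT.
rewrite [leRHS](bigID (mem F))/= -[leLHS]addr0; apply: lerD; last first.
  by apply: sumr_ge0 => y _; rewrite mulr1.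
rewrite -[leRHS]big_filter (perm_big [seq y <- undup (F ++ neighbors z) | y \in F])/=.
  by apply: ler_sum => y _; rewrite mulr1.
apply: uniq_perm; rewrite ?filter_uniq ?undup_uniq// => y.
by rewrite mem_filter mem_undup mem_cat; case: (y \in F).
Qed.

(** Every iterate has mass at most [m], and the coefficients of the series add up to 1. *)
Lemma heat_mass_le f m t : fun_bounded f -> (forall x, 0 <= f x) -> 0 <= t ->
  mass_le f m -> mass_le (heat f t) m.
Proof.
move=> bf f0 t0 fm F uF; have bm := iter_markov_bounded bf.
have itm k : mass_le (fun x => iter_markov f x k) m.
  elim: k => // k ih; apply: markov_mass_le ih => x.
  by rewrite -(iter_markov_cst 0 x k); exact: iter_markov_le.
have -> : \sum_(y <- F) mu y * heat f t y = expR (- (D * t)) *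
    egf (fun k => \sum_(y <- F) mu y * iter_markov f y k) (D * t).
  by rewrite egf_sum// mulr_sumr; apply: eq_bigr => y _; rewrite mulrCA.
have e : expR (- (D * t)) * expR (D * t) = 1 by rewrite -expRD addNr expR0.
rewrite -[leRHS]mul1r -e -mulrA ler_pM2l ?expR_gt0//.
rewrite [leRHS]mulrC -egf_cst; apply: egf_le.
- exact: seq_bounded_sum.
- by exists `|m|.
- by move=> k; exact: itm.
- by rewrite mulr_ge0// ltW.
Qed.

End HeatSemigroup.

(** * Maximum principle and evolution of the curvature term *)

Section MaximumPrinciple.
Variables (R : realType) (G : weighted_graph R) (D : R).
Hypotheses (D_gt0 : 0 < D) (deg_le : forall x : G, deg x <= D * mu x).

(* [Laplacian + D] is [D] times a Markov operator, so that the bound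
   [S * expR (2 D t)] on a subsolution improves to a third of itself. *)
Lemma subsolution_le0 (F dF : R -> G -> R) (T M : R) :
  (forall t x, 0 <= t <= T -> F t x <= M) ->
  (forall t x, 0 <= t <= T -> is_derive t (1 : R) (fun s => F s x) (dF t x)) ->
  (forall t x, 0 <= t <= T -> dF t x <= laplacian (F t) x) ->
  (forall x, F 0 x <= 0) ->
  forall t x, 0 <= t <= T -> F t x <= 0.
Proof.
move=> FM dFP dF_le F0.
have step S : 0 <= S ->
    (forall t x, 0 <= t <= T -> F t x <= S * expR (2 * D * t)) ->
    forall t x, 0 <= t <= T -> F t x <= S / 3 * expR (2 * D * t).
  move=> S0 FS t x /andP[t0 tT].
  have dexp (c s : R) : is_derive s (1 : R) (fun r => expR (c * r)) (c * expR (c * s)).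
    have dc : is_derive s (1 : R) (fun r => c * r) c.
      apply: (is_derive_eq (is_derive_mulf (is_derive_cstf c s) (is_derive_id s 1))).
      by rewrite mul0r add0r mulr1.
    by apply: (is_derive_eq (is_derive_compf dc (is_derive_expR (c * s))));
      rewrite mulrC.
  (* The integrating factor [expR (D * s)] completes the Laplacian to [D * markov]; integrating the
     resulting bound [D * S * expR (3 * D * s)] produces the factor 1/3. *)
  pose H s := expR (D * s) * F s x - S / 3 * expR (3 * D * s).
  pose dH s := D * expR (D * s) * F s x + expR (D * s) * dF s x
    - (0 * expR (3 * D * s) + S / 3 * (3 * D * expR (3 * D * s))).
  have le_H : H t <= H 0.
    apply: (@le_of_is_derive_le0 R H dH 0 t t0) => s /andP[s0 st].
      have sT : 0 <= s <= T by rewrite s0 (le_trans st).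
      have d1 := is_derive_mulf (dexp D s) (dFP s x sT).
      have d2 := is_derive_mulf (is_derive_cstf (S / 3) s) (dexp (3 * D) s).
      exact: is_derive_subf d1 d2.
    have sT : 0 <= s <= T by rewrite s0 (le_trans st).
    have markov_FS : D * F s x + laplacian (F s) x <= D * (S * expR (2 * D * s)).
      rewrite -[leLHS](_ : D * markov D (F s) x = _); last first.
        by rewrite /markov; field; rewrite gt_eqF.
      rewrite ler_pM2l// -[leRHS](markov_cst D _ x).
      by apply: markov_le => // y; exact: FS.
    have -> : dH s = expR (D * s) * (D * F s x + dF s x
        - D * (S * expR (2 * D * s))).
      rewrite /dH (_ : expR (3 * D * s) = expR (D * s) * expR (2 * D * s)).
        by field.
      by rewrite -expRD; congr expR; ring.
    rewrite mulr_ge0_le0 ?expR_ge0// subr_le0; apply: le_trans markov_FS.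
    by rewrite lerD2l; exact: dF_le.
  have H0 : H 0 <= 0.
    rewrite /H !mulr0 expR0 mul1r mulr1 subr_le0 (le_trans (F0 x))//.
    by rewrite divr_ge0.
  have := le_trans le_H H0; rewrite /H subr_le0.
  rewrite (_ : expR (3 * D * t) = expR (D * t) * expR (2 * D * t)); last first.
    by rewrite -expRD; congr expR; ring.
  by rewrite mulrCA ler_pM2l ?expR_gt0.
have all_k k t x : 0 <= t <= T ->
    F t x <= Num.max M 0 * 3^-1 ^+ k * expR (2 * D * t).
  elim: k t x => [|k ih] t x tT.
    rewrite expr0 mulr1 (le_trans (FM t x tT))//.
    have M0 : 0 <= Num.max M 0 by rewrite le_max lexx orbT.
    rewrite (@le_trans _ _ (Num.max M 0))// ?le_max ?lexx//.
    rewrite ler_peMr// -[leLHS]expR0 ler_expR.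
    by case/andP: tT => t0 _; rewrite !mulr_ge0// ltW.
  rewrite exprSr mulrA; apply: step tT => //.
  by rewrite mulr_ge0 ?exprn_ge0 ?invr_ge0// le_max lexx orbT.
move=> t x tT; apply: (@le0_of_le_geometric _ _ (Num.max M 0 * expR (2 * D * t))) => k.
by rewrite mulrAC; exact: all_k.
Qed.

End MaximumPrinciple.

(** * Time derivatives along the heat equation *)

Section TimeDerivative.
Variables (R : realType) (G : weighted_graph R) (psi : R -> R).
Hypothesis psi_C1 : C1_pos psi.
Implicit Types (x y : G) (f : G -> R).

Lemma is_derive_laplacian (F : R -> G -> R) (dF : G -> R) t x :
  (forall y, is_derive t (1 : R) (fun s => F s y) (dF y)) ->
  is_derive t (1 : R) (fun s => laplacian (F s) x) (laplacian dF x).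
Proof.
move=> d; rewrite laplacianE.
rewrite (_ : (fun s => _) = fun s => (mu x)^-1 *
    \sum_(y <- neighbors x) weight x y * (F s y - F s x)); last first.
  by apply/funext => s; rewrite laplacianE.
have dc (c : R) (h : R -> R) dh : is_derive t (1 : R) h dh ->
    is_derive t (1 : R) (fun s => c * h s) (c * dh).
  move=> dh0; apply: (is_derive_eq (is_derive_mulf (is_derive_cstf c t) dh0)).
  by rewrite mul0r add0r.
by apply: dc; apply: is_derive_sumf => y; apply: dc.
Qed.

(** The logarithmic derivative of [u t y / u t x] is the difference of the values of
    [laplacian u / u] at [y] and [x], which is the last factor in [Omega_psi]. *)
Lemma is_derive_psi_laplacian (u : R -> G -> R) t x : (forall y, 0 < u t y) ->
  (forall y, is_derive t (1 : R) (fun s => u s y) (laplacian (u t) y)) ->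
  is_derive t (1 : R) (fun s => psi_laplacian psi (u s) x) (Omega_psi psi (u t) x).
Proof.
move=> u0 du; apply: is_derive_laplacian => y.
have dV : is_derive t (1 : R) (fun s => (u s x)^-1)
    (- (u t x ^- 2) * laplacian (u t) x).
  apply: (is_derive_eq (is_deriveV _ (du x))); first by rewrite gt_eqF.
  by rewrite /GRing.scale.
have dq := is_derive_mulf (du y) dV.
have q0 : 0 < u t y / u t x by rewrite divr_gt0.
apply: (is_derive_eq (is_derive_compf dq (is_derive_psi psi_C1 q0))).
rewrite -mulrA; congr (_ * _).
by field; rewrite !gt_eqF.
Qed.

Lemma mul_Gamma_psi f x : f x != 0 -> f x * Gamma_psi psi f x =
  derive1 psi 1 * laplacian f x - f x * psi_laplacian psi f x.
Proof.
move=> f0; rewrite /Gamma_psi /psi_laplacian !laplacianE.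
rewrite mulrCA [X in X - _]mulrCA [X in _ - X]mulrCA -mulrBr; congr (_ * _).
rewrite !mulr_sumr -sumrB; apply: eq_bigr => y _.
by rewrite /psi_bar; field.
Qed.

(* The quantity [u * Gamma_psi u] is differentiated in this division-free form,
   which agrees with it only where [u] does not vanish. *)
Lemma is_derive_mul_Gamma_psi (u : R -> G -> R) (t : R) x : (forall y, 0 < u t y) ->
  (forall y, is_derive t (1 : R) (fun s => u s y) (laplacian (u t) y)) ->
  is_derive t (1 : R) (fun s => derive1 psi 1 * laplacian (u s) x
    - u s x * psi_laplacian psi (u s) x)
  (laplacian (fun y => derive1 psi 1 * laplacian (u t) y
    - u t y * psi_laplacian psi (u t) y) x - 2 * u t x * Gamma2_psi psi (u t) x).
Proof.
move=> u0 du; have un0 : u t x != 0 by rewrite gt_eqF.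
have d1 := is_derive_mulf (is_derive_cstf (derive1 psi 1) t)
  (is_derive_laplacian x du).
have d2 := is_derive_mulf (du x) (is_derive_psi_laplacian x u0 du).
apply: (is_derive_eq (is_derive_subf d1 d2)).
rewrite [in RHS](_ : (fun y => _) = (fun y => derive1 psi 1 *
    laplacian (u t) y + -1 * (u t y * psi_laplacian psi (u t) y))); last first.
  by apply/funext => y; rewrite mulN1r.
rewrite laplacian_lin laplacianZ /Gamma2_psi.
by field; exact: un0.
Qed.

End TimeDerivative.

(** * The evolution inequality with multipliers *)

Section LinearizedLiYau.
Variables (R : realType) (G : weighted_graph R) (D : R) (psi : R -> R) (n K : R).
Hypotheses (D_gt0 : 0 < D) (deg_le : forall x : G, deg x <= D * mu x).
Hypotheses (psi_C1 : C1_pos psi) (psi_concave : concave_pos psi).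
Hypotheses (cd : CDpsi G psi n (- K)).
Variables (f : G -> R) (eps M : R).
Hypotheses (eps_gt0 : 0 < eps) (fM : forall x, eps <= f x <= M).
Local Notation u := (heat D f).
Local Notation p := (derive1 psi 1).

Lemma initial_bounded : fun_bounded f.
Proof.
exists M => x; have /andP[ef fm] := fM x.
by rewrite ger0_norm// (le_trans _ ef)// ltW.
Qed.

Lemma heat_gt0 t x : 0 <= t -> 0 < u t x.
Proof.
move=> t0; have /andP[+ _] := heat_bounds D_gt0 deg_le fM x t0.
exact: lt_le_trans.
Qed.

Lemma is_derive_heat_initial t x :
  is_derive t (1 : R) (fun s => u s x) (laplacian (u t) x).
Proof. by apply: is_derive_heat => //; exact: initial_bounded. Qed.

Lemma Gamma_psi_ge0 (g : G -> R) x : (forall y, 0 < g y) -> 0 <= Gamma_psi psi g x.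
Proof.
move=> g0; rewrite /Gamma_psi /psi_laplacian laplacianE.
apply: mulr_ge0; first by rewrite invr_ge0 ltW ?mu_gt0.
rewrite big_seq; apply: sumr_ge0 => y.
rewrite in_neighbors => xy; rewrite divff ?gt_eqF// psi_bar1 subr0.
by rewrite mulr_ge0 ?psi_bar_ge0 ?divr_gt0// ltW// weight_gt0.
Qed.

Lemma Gamma_psi_le (g : G -> R) x (B : R) : g x != 0 -> 0 <= B ->
  (forall y, adj x y -> psi_bar psi (g y / g x) <= B) -> Gamma_psi psi g x <= D * B.
Proof.
move=> g0 B0 gB; rewrite /Gamma_psi /psi_laplacian laplacianE.
have m0 := mu_gt0 x.
rewrite mulrC ler_pdivrMr// mulrAC.
apply: (@le_trans _ _ (deg x * B)); last by rewrite ler_wpM2r.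
rewrite degE mulr_suml; apply: ler_neighbors => y xy.
by rewrite divff// psi_bar1 subr0 ler_wpM2l ?gB// ltW// weight_gt0.
Qed.

Lemma laplacian_bounded (g : G -> R) x : (forall y, eps <= g y <= M) ->
  `|laplacian g x| <= D * M.
Proof.
move=> gM; have /andP[eg gm] := gM x.
have E : laplacian g x = D * (markov D g x - g x).
  by rewrite /markov; field; rewrite gt_eqF.
have h1 : markov D g x <= M.
  rewrite -[leRHS](markov_cst D M x); apply: markov_le => // y.
  by have /andP[] := gM y.
have h2 : eps <= markov D g x.
  rewrite -[leLHS](markov_cst D eps x); apply: markov_le => // y.
  by have /andP[] := gM y.
rewrite E normrM gtr0_norm// ler_pM2l// ler_norml.
have e0 := eps_gt0; apply/andP; split.
  lra.
lra.
Qed.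

(* [V], [A], [B] are multipliers: dividing by [u], the evolution inequality for
   [V * u * Gamma - A * p * Delta u - B * u] is linear in the curvature term,
   with [q] in the role of [Gamma] and [z] in that of [- psi_laplacian]. *)
Lemma heat_multiplier_le (V A B dV dA dB : R -> R) (T : R) :
  (forall t : R, 0 <= t <= T -> is_derive t (1 : R) V (dV t)) ->
  (forall t : R, 0 <= t <= T -> is_derive t (1 : R) A (dA t)) ->
  (forall t : R, 0 <= t <= T -> is_derive t (1 : R) B (dB t)) ->
  (forall t : R, 0 <= t <= T -> 0 <= V t) ->
  (forall t q z : R, 0 <= t <= T -> 0 <= q ->
    dV t * q + 2 * V t * (K * q - n^-1 * z ^+ 2) - dA t * (q - z) - dB t <= 0) ->
  (forall x, V 0 * Gamma_psi psi f x - A 0 * (p * laplacian f x / f x) - B 0 <= 0) ->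
  forall (t : R) x, 0 <= t <= T ->
  V t * Gamma_psi psi (u t) x <= A t * (p * laplacian (u t) x / u t x) + B t.
Proof.
move=> dVP dAP dBP V0 ineq init t x tT.
have T0 : 0 <= T by case/andP: tT; exact: le_trans.
have uM (s : R) y : 0 <= s -> eps <= u s y <= M by move=> s0; exact: heat_bounds.
have M0 : 0 < M by have /andP[e1 e2] := fM x; exact: lt_le_trans (le_trans e1 e2).
have epsM : eps / M <= M / eps.
  have /andP[e1 e2] := fM x; have eM := le_trans e1 e2.
  by rewrite ler_pdivrMr// mulrAC ler_pdivlMr// ler_pM// ltW.
(* Quotients of values of [u] stay in [[eps / M, M / eps]]; the resulting bound on [Gamma_psi]
   supplies the upper bound that the maximum principle asks for. *)
have [Bb Bb0 Bbar] := psi_bar_bounded psi_C1 psi_concave (divr_gt0 eps_gt0 M0) epsM.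
have GamB (s : R) y : 0 <= s -> Gamma_psi psi (u s) y <= D * Bb.
  move=> s0; apply: Gamma_psi_le => // [|z yz]; first by rewrite gt_eqF// heat_gt0.
  have /andP[h1 h2] := uM s y s0; have /andP[h3 h4] := uM s z s0.
  have h0 := heat_gt0 y s0; apply: Bbar; apply/andP; split.
    rewrite ler_pdivrMr// mulrAC ler_pdivlMr//.
    by apply: ler_pM => //; exact: ltW.
  rewrite ler_pdivrMr// mulrAC ler_pdivlMr//.
  by apply: ler_pM => //; rewrite ltW// (lt_le_trans eps_gt0).
have [NV NV0 NVP] := derivable_bounded T0 dVP.
have [NA NA0 NAP] := derivable_bounded T0 dAP.
have [NB NB0 NBP] := derivable_bounded T0 dBP.
pose g (s : R) y : R := p * laplacian (u s) y - u s y * psi_laplacian psi (u s) y.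
have gE (s : R) y : 0 <= s -> g s y = u s y * Gamma_psi psi (u s) y.
  by move=> s0; rewrite mul_Gamma_psi// gt_eqF// heat_gt0.
pose F s y := V s * g s y + (- A s * (p * laplacian (u s) y) + - B s * u s y).
pose dg s y := laplacian (g s) y - 2 * u s y * Gamma2_psi psi (u s) y.
pose dF s y := dV s * g s y + V s * dg s y
  + ((- dA s * (p * laplacian (u s) y) + - A s * (p * laplacian (laplacian (u s)) y))
  + (- dB s * u s y + - B s * laplacian (u s) y)).
suff : F t x <= 0.
  have t0 : 0 <= t by case/andP: tT.
  have ut := heat_gt0 x t0; rewrite /F gE// => F_le0.
  rewrite -(ler_pM2r ut) -subr_le0; apply: le_trans F_le0.
  by rewrite le_eqVlt; apply/orP; left; apply/eqP; field; rewrite gt_eqF.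
apply: (@subsolution_le0 _ _ D D_gt0 deg_le F dF T
  (NV * (M * (D * Bb)) + (NA * (`|p| * (D * M)) + NB * M))) => //.
- move=> s y sT; have s0 : 0 <= s by case/andP: sT.
  have /andP[um uM'] := uM s y s0; have u0 := heat_gt0 y s0.
  have Gam0 : 0 <= Gamma_psi psi (u s) y by apply: Gamma_psi_ge0 => z; exact: heat_gt0.
  have g0 : 0 <= g s y by rewrite gE// mulr_ge0// ltW.
  have gM : g s y <= M * (D * Bb)
    by rewrite gE//; apply: ler_pM => //; [exact: ltW|exact: GamB].
  have L0 : `|laplacian (u s) y| <= D * M by apply: laplacian_bounded => z; exact: uM.
  rewrite /F; apply: lerD; last apply: lerD.
  + apply: (le_trans (ler_norm _)); rewrite normrM (ger0_norm g0).
    by apply: ler_pM => //; exact: NVP.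
  + apply: (le_trans (ler_norm _)).
    rewrite (normrM (- A s)) (normrM p) normrN.
    apply: ler_pM; [exact: normr_ge0|exact: mulr_ge0|exact: NAP|].
    by apply: ler_wpM2l.
  + apply: (le_trans (ler_norm _)).
    rewrite (normrM (- B s)) normrN (gtr0_norm u0).
    by apply: ler_pM => //; [exact: ltW|exact: NBP].
- move=> s y sT; have s0 : 0 <= s by case/andP: sT.
  have du z := is_derive_heat_initial s z.
  have dgs : is_derive s (1 : R) (fun s => g s y) (dg s y).
    by apply: is_derive_mul_Gamma_psi => // z; exact: heat_gt0.
  have dL := is_derive_laplacian y du.
  have dpL := is_derive_mulf (is_derive_cstf p s) dL.
  have dNA : is_derive s (1 : R) (fun s => - A s) (- dA s).
    by apply: is_deriveN; exact: dAP.
  have dNB : is_derive s (1 : R) (fun s => - B s) (- dB s).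
    by apply: is_deriveN; exact: dBP.
  have d1 := is_derive_mulf (dVP s sT) dgs.
  have d2 := is_derive_mulf dNA dpL.
  have d3 := is_derive_mulf dNB (du y).
  apply: (is_derive_eq (is_derive_addf d1 (is_derive_addf d2 d3))).
  by rewrite /dF mul0r add0r.
- move=> s y sT; have s0 : 0 <= s by case/andP: sT.
  have u0 z := heat_gt0 z s0; have un0 : u s y != 0 by rewrite gt_eqF.
  have LF : laplacian (F s) y = V s * laplacian (g s) y
      + (- A s * (p * laplacian (laplacian (u s)) y) + - B s * laplacian (u s) y).
    rewrite (laplacian_lin3 (V s) (- A s) (- B s) (g s)
      (fun z => p * laplacian (u s) z) (u s) y).
    by rewrite laplacianZ.
  pose q := Gamma_psi psi (u s) y; pose z := - psi_laplacian psi (u s) y.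
  have q0 : 0 <= q by exact: Gamma_psi_ge0.
  have gq : g s y = u s y * q by rewrite gE.
  have pL : p * laplacian (u s) y = u s y * (q - z).
    by rewrite /z opprK mulrDr -gq /g subrK.
  (* The curvature condition enters here, multiplied by [V s >= 0]; what remains is [ineq] times
     [u s y]. *)
  have := ineq s q z sT q0; have := cd u0 y.
  rewrite -/q -(sqrrN (psi_laplacian _ _ _)) -/z => cdy ineqs.
  have V0s := V0 s sT.
  rewrite LF /dF gq pL -subr_le0 /dg.
  set G2 := Gamma2_psi psi (u s) y in cdy *.
  have VG : V s * (n^-1 * z ^+ 2 + - K * q) <= V s * G2 by exact: ler_wpM2l.
  rewrite [leLHS](_ : _ = u s y * (dV s * q - 2 * (V s * G2)
    - dA s * (q - z) - dB s)); last by ring.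
  by rewrite mulr_ge0_le0 ?(ltW (u0 y))//; lra.
- move=> y; have fy : 0 < f y by have /andP[+ _] := fM y; exact: lt_le_trans.
  rewrite /F gE//; have -> : u 0 = f by apply/funext => z; exact: heat0.
  have := init y; rewrite -(ler_pM2l fy) mulr0; apply: le_trans.
  by rewrite le_eqVlt; apply/orP; left; apply/eqP; field; rewrite gt_eqF.
Qed.

End LinearizedLiYau.

(** * Li-Yau and Harnack inequalities, and volume doubling *)

(** This is applied to the distances of two adjacent vertices from a centre, cut off at [N]. *)
Lemma minn_consecutive (a b N : nat) : (a <= b.+1)%N -> (b <= a.+1)%N ->
  [\/ minn a N = minn b N, minn a N = (minn b N).+1 | minn b N = (minn a N).+1].
Proof.
have le_minn c d : (c <= d.+1)%N -> (minn c N <= (minn d N).+1)%N.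
  move=> cd; rewrite -minnSS leq_min (leq_trans (geq_minl _ _) cd).
  by rewrite (leq_trans (geq_minr _ _) (leqnSn N)).
move=> /le_minn ab /le_minn ba.
have [h|h|h] := ltngtP (minn a N) (minn b N); [apply: Or33|apply: Or32|exact: Or31].
  by apply/eqP; rewrite eqn_leq ba h.
by apply/eqP; rewrite eqn_leq ab h.
Qed.

(** * Graph distance and paths *)

Section GraphDistance.
Variables (R : realType) (G : weighted_graph R).
Implicit Types (x y z : G).

Lemma graph_distP x y : exists p : seq G,
  [/\ path adj x p, last x p = y & size p = graph_dist x y].
Proof.
rewrite /graph_dist; case: ex_minnP => k /asboolP[p [? ? ?]] _.
by exists p.
Qed.

Lemma graph_dist_le x y (p : seq G) : path adj x p -> last x p = y ->
  (graph_dist x y <= size p)%N.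
Proof.
move=> xp py; rewrite /graph_dist; case: ex_minnP => k _; apply.
by apply/asboolP; exists p.
Qed.

Lemma graph_distxx x : graph_dist x x = 0%N.
Proof. by apply/eqP; rewrite -leqn0; apply: (@graph_dist_le _ _ [::]). Qed.

Lemma graph_dist_adj x y z : adj y z -> (graph_dist x z <= (graph_dist x y).+1)%N.
Proof.
move=> yz; have [p [xp py <-]] := graph_distP x y.
rewrite -(size_rcons p z); apply: graph_dist_le; last by rewrite last_rcons.
by rewrite rcons_path xp py.
Qed.

End GraphDistance.

(** * Li-Yau estimates for positive solutions *)

Section LiYau.
Variables (R : realType) (G : weighted_graph R) (D : R) (psi : R -> R) (n K : R).
Hypotheses (D_gt0 : 0 < D) (deg_le : forall x : G, deg x <= D * mu x).
Hypotheses (psi_C1 : C1_pos psi) (psi_concave : concave_pos psi).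
Hypotheses (n_gt0 : 0 < n) (K_ge0 : 0 <= K) (cd : CDpsi G psi n (- K)).
Local Notation p := (derive1 psi 1).
Hypothesis p_gt0 : 0 < p.

Section Solution.
Variables (f : G -> R) (eps M : R).
Hypotheses (eps_gt0 : 0 < eps) (fM : forall x, eps <= f x <= M).
Local Notation u := (heat D f).

Lemma Gamma_psi_heat_ge0 (t : R) x : 0 <= t -> 0 <= Gamma_psi psi (u t) x.
Proof.
move=> t0; apply: Gamma_psi_ge0 => // y.
exact: (heat_gt0 D_gt0 deg_le eps_gt0 fM).
Qed.

(** The multiplier [V = s^2] removes the initial data, [A' = V' + 2 K V] cancels the terms in [q],
    and [B'] is the constant that completes the square in [z]. *)
Lemma li_yau (t : R) x : 0 <= t ->
  t ^+ 2 * Gamma_psi psi (u t) x <=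
  (t ^+ 2 + 2 / 3 * K * t ^+ 3) * (p * laplacian (u t) x / u t x)
  + n / 2 * (t + K * t ^+ 2 + K ^+ 2 / 3 * t ^+ 3).
Proof.
move=> t0.
pose V (s : R) := 1 * s ^+ 2.
pose A (s : R) := 1 * s ^+ 2 + 2 / 3 * K * s ^+ 3.
pose B (s : R) := n / 2 * s ^+ 1 + (n / 2 * K * s ^+ 2 + n / 2 * (K ^+ 2 / 3) * s ^+ 3).
have dV (s : R) : 0 <= s <= t -> is_derive s (1 : R) V (2 * s).
  by move=> _; apply: (is_derive_eq (is_derive_monomial _ _ _)); rewrite /=; ring.
have dA (s : R) : 0 <= s <= t -> is_derive s (1 : R) A (2 * s + 2 * K * s ^+ 2).
  move=> _; apply: (is_derive_eq (is_derive_addf (is_derive_monomial _ _ _)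
    (is_derive_monomial _ _ _))).
  by rewrite /=; field.
have dB (s : R) : 0 <= s <= t -> is_derive s (1 : R) B (n / 2 * (1 + K * s) ^+ 2).
  move=> _; apply: (is_derive_eq (is_derive_addf (is_derive_monomial _ _ _)
    (is_derive_addf (is_derive_monomial _ _ _) (is_derive_monomial _ _ _)))).
  by rewrite /=; field.
have V0 (s : R) : 0 <= s <= t -> 0 <= V s by move=> _; rewrite /V mul1r sqr_ge0.
have ineq (s q z : R) : 0 <= s <= t -> 0 <= q ->
    2 * s * q + 2 * V s * (K * q - n^-1 * z ^+ 2)
    - (2 * s + 2 * K * s ^+ 2) * (q - z) - n / 2 * (1 + K * s) ^+ 2 <= 0.
  move=> _ _; rewrite [leLHS](_ : _ = - (2 / n * (s * z - n / 2 * (1 + K * s)) ^+ 2)).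
    by rewrite oppr_le0 mulr_ge0 ?sqr_ge0// divr_ge0// ltW.
  by rewrite /V; field; rewrite gt_eqF.
have init y : V 0 * Gamma_psi psi f y - A 0 * (p * laplacian f y / f y) - B 0 <= 0.
  by rewrite /V /A /B !expr0n/= !mulr0 !addr0 !mul0r !subr0.
have := heat_multiplier_le D_gt0 deg_le psi_C1 psi_concave cd eps_gt0 fM
  dV dA dB V0 ineq init x (t := t).
rewrite lexx t0 => /(_ isT); rewrite /V /A /B mul1r expr1 => /le_trans; apply.
by rewrite lerD2l le_eqVlt; apply/orP; left; apply/eqP; ring.
Qed.

(* Minimizing over the multiplier [gam] would give a bound in
   [sqrt (S / t)]; the constraint on [gam] absorbs the curvature. *)
Lemma laplacian_heat_ge (S gam t : R) x :
  (forall y, Gamma_psi psi f y <= S) -> 0 < gam -> n * K <= 2 * gam -> 0 < t ->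
  - (n * S / (4 * gam * t) + gam / 2) <= p * laplacian (u t) x / u t x.
Proof.
move=> fS gam0 Kgam t0; have n0 := n_gt0.
(* A constant [V] retains the initial bound [S]. The slope of [A] completes the terms in [z] to a
   multiple of [(z - gam)^2] and leaves [q] the coefficient [2 K - 4 gam / n], nonpositive by the
   constraint on [gam]. *)
pose V (s : R) := 1 * s ^+ 0.
pose A (s : R) := 4 * gam / n * s ^+ 1.
pose B (s : R) := S * s ^+ 0 + 2 / n * gam ^+ 2 * s ^+ 1.
have dV (s : R) : 0 <= s <= t -> is_derive s (1 : R) V 0.
  by move=> _; apply: (is_derive_eq (is_derive_monomial _ _ _)); rewrite /=; ring.
have dA (s : R) : 0 <= s <= t -> is_derive s (1 : R) A (4 * gam / n).
  by move=> _; apply: (is_derive_eq (is_derive_monomial _ _ _)); rewrite /=; ring.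
have dB (s : R) : 0 <= s <= t -> is_derive s (1 : R) B (2 / n * gam ^+ 2).
  move=> _; apply: (is_derive_eq (is_derive_addf (is_derive_monomial _ _ _)
    (is_derive_monomial _ _ _))).
  by rewrite /=; ring.
have V0 (s : R) : 0 <= s <= t -> 0 <= V s by move=> _; rewrite /V expr0 mulr1.
have ineq (s q z : R) : 0 <= s <= t -> 0 <= q ->
    0 * q + 2 * V s * (K * q - n^-1 * z ^+ 2)
    - 4 * gam / n * (q - z) - 2 / n * gam ^+ 2 <= 0.
  move=> _ q0; rewrite /V [leLHS](_ : _ = - (2 / n * (z - gam) ^+ 2)
    - 2 / n * ((2 * gam - n * K) * q)).
    have h1 : 0 <= 2 / n * (z - gam) ^+ 2 by rewrite mulr_ge0 ?sqr_ge0// divr_ge0// ltW.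
    have h2 : 0 <= 2 / n * ((2 * gam - n * K) * q).
      by rewrite !mulr_ge0 ?subr_ge0 ?invr_ge0// ltW.
    by lra.
  by field; rewrite gt_eqF.
have init y : V 0 * Gamma_psi psi f y - A 0 * (p * laplacian f y / f y) - B 0 <= 0.
  by rewrite /V /A /B !expr0 expr1 !mulr0 mul0r addr0 mulr1 mul1r subr0 mulr1 subr_le0.
have := heat_multiplier_le D_gt0 deg_le psi_C1 psi_concave cd eps_gt0 fM
  dV dA dB V0 ineq init x (t := t).
rewrite lexx (ltW t0) => /(_ isT); rewrite /V /A /B !expr0 expr1 !mulr1 mul1r.
set X := p * _ / _; move/(le_trans (Gamma_psi_heat_ge0 x (ltW t0))) => H.
have c0 : 0 < 4 * gam / n * t by rewrite mulr_gt0// divr_gt0// mulr_gt0.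
rewrite -(ler_pM2l c0) -subr_ge0; apply: le_trans H _.
rewrite le_eqVlt; apply/orP; left; apply/eqP; field.
by rewrite !gt_eqF.
Qed.

(** With [a = K s], the Li-Yau error [1 + a + a^2 / 3] is at most [(1 + 2 a / 3) (1 + a)], so it
    shares the factor of the Laplacian term. Replacing that factor by [1 + K T] makes the bound
    uniform in time. *)
Lemma log_derivative_ge (s T : R) x : 0 < s -> s <= T ->
  Gamma_psi psi (u s) x / (p * (1 + K * T)) <=
  laplacian (u s) x / u s x + n / (2 * p) * (s^-1 + K).
Proof.
move=> s0 sT; have n0 := n_gt0; have K0 := K_ge0; have p0 := p_gt0.
have Ks0 : 0 <= K * s by rewrite mulr_ge0// ltW.
have KsT : K * s <= K * T by rewrite ler_wpM2l.
have Gam0 := Gamma_psi_heat_ge0 x (ltW s0).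
have := li_yau x (ltW s0).
set Gm := Gamma_psi _ _ _ in Gam0 *; set L := laplacian _ x => LY.
pose Y := p * (L / u s x + n / (2 * p) * (s^-1 + K)).
have alpha0 : 0 < 1 + 2 / 3 * (K * s) by lra.
have GY : Gm <= (1 + 2 / 3 * (K * s)) * Y.
  have s20 : 0 < s ^+ 2 by rewrite exprn_gt0.
  rewrite -(ler_pM2l s20); apply: (le_trans LY).
  rewrite [leRHS](_ : _ = (s ^+ 2 + 2 / 3 * K * s ^+ 3) * (p * L / u s x)
    + n / 2 * (s * ((1 + 2 / 3 * (K * s)) * (1 + K * s)))); last first.
    rewrite /Y; field.
    by rewrite !gt_eqF// (heat_gt0 D_gt0 deg_le eps_gt0 fM)// ltW.
  rewrite lerD2l ler_pM2l ?divr_gt0//.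
  rewrite [leLHS](_ : _ = s * (1 + K * s + (K * s) ^+ 2 / 3)); last by field.
  rewrite ler_pM2l//; have := sqr_ge0 (K * s); lra.
have Y0 : 0 <= Y by rewrite -(pmulr_rge0 _ alpha0) (le_trans Gam0).
rewrite ler_pdivrMr; last by rewrite mulr_gt0//; lra.
apply: (le_trans GY).
rewrite [leRHS](_ : _ = (1 + K * T) * Y); last by rewrite /Y; ring.
by rewrite ler_wpM2r//; lra.
Qed.

(** * The parabolic Harnack inequality *)

Section Harnack.
Variables (mm wm h : R).
Hypotheses (mu_le : forall x : G, mu x <= mm) (wm_gt0 : 0 < wm)
  (wm_le : forall x y : G, adj x y -> wm <= weight x y)
  (h_gt0 : 0 < h)
  (ln2_le : forall s : R, 1 < s -> ln s ^+ 2 <= h * psi_bar psi s).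

(** All terms of [Gamma_psi] are nonnegative, so the one of [y] may be kept alone. The jump from [x]
    to [y] has to be upward because [ln2_le] concerns ratios above 1. *)
Lemma Gamma_psi_ge (g : G -> R) x y : (forall z, 0 < g z) -> adj x y ->
  g x < g y -> wm / (mm * h) * (ln (g y) - ln (g x)) ^+ 2 <= Gamma_psi psi g x.
Proof.
move=> g0 xy gxy; have mx := mu_gt0 x; have m0 : 0 < mm := lt_le_trans mx (mu_le x).
have q1 : 1 < g y / g x by rewrite ltr_pdivlMr// mul1r.
rewrite -ln_div ?posrE//.
have lnq := ln2_le q1; have bq0 : 0 <= psi_bar psi (g y / g x).
  by apply: psi_bar_ge0 => //; exact: divr_gt0.
apply: (@le_trans _ _ (wm / mm * psi_bar psi (g y / g x))).
  rewrite [leLHS](_ : _ = wm / mm * (ln (g y / g x) ^+ 2 / h)); last first.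
    by rewrite invfM; ring.
  apply: ler_wpM2l; first by rewrite divr_ge0// ltW.
  by rewrite ler_pdivrMr// [leRHS]mulrC.
rewrite /Gamma_psi /psi_laplacian laplacianE.
rewrite (bigD1_seq y) ?in_neighbors ?neighbors_uniq//=.
rewrite divff ?gt_eqF// psi_bar1 subr0 [leRHS]mulrDr -[leLHS]addr0.
apply: lerD.
  rewrite mulrA; apply: ler_wpM2r => //; rewrite [leLHS]mulrC.
  apply: ler_pM; [by rewrite invr_ge0 ltW|exact: ltW| |exact: wm_le].
  by rewrite lef_pV2// posrE.
apply: mulr_ge0; first by rewrite invr_ge0 ltW.
rewrite big_seq_cond; apply: sumr_ge0 => z; rewrite in_neighbors => /andP[xz _].
rewrite subr0 mulr_ge0//; first by rewrite ltW// weight_gt0.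
by apply: psi_bar_ge0 => //; exact: divr_gt0.
Qed.
(** The correction added to [ln u] is the one that makes the Li-Yau inequality a statement of
    monotonicity in time. *)
Definition log_heat x (s : R) : R := ln (u s x) + n / (2 * p) * (ln s + K * s).

Lemma is_derive_log_heat x (s : R) : 0 < s -> is_derive s (1 : R) (log_heat x)
  (laplacian (u s) x / u s x + n / (2 * p) * (s^-1 + K)).
Proof.
move=> s0.
have us0 : 0 < u s x by apply: (heat_gt0 D_gt0 deg_le eps_gt0 fM); exact: ltW.
have d1 := is_derive_compf (is_derive_heat_initial D_gt0 deg_le eps_gt0 fM s x)
  (is_derive1_ln us0).
have d2 := is_derive_addf (is_derive1_ln s0) (is_derive_monomial K s 1).
have d3 := is_derive_mulf (is_derive_cstf (n / (2 * p)) s) d2.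
rewrite /log_heat (_ : (fun s => _) = fun s => ln (u s x) +
    n / (2 * p) * (ln s + K * s ^+ 1)); last first.
  by apply/funext => v; rewrite expr1.
apply: (is_derive_eq (is_derive_addf d1 d3)).
by rewrite mul0r add0r expr0 !mulr1 mulrC.
Qed.

Lemma log_heat_derivative_ge0 x (s : R) : 0 < s ->
  0 <= laplacian (u s) x / u s x + n / (2 * p) * (s^-1 + K).
Proof.
move=> s0; apply: le_trans (log_derivative_ge x s0 (lexx s)).
apply: divr_ge0; first by apply: Gamma_psi_heat_ge0; exact: ltW.
by rewrite mulr_ge0 ?addr_ge0 ?mulr_ge0// ltW.
Qed.

(** Riccati comparison: while [u] is smaller at [y] than at [x], the edge contributes to [Gamma_psi]
    at [y] the square of the logarithmic gap, so [log_heat y] grows at least at that rate up to a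
    constant. The corrections cancel in the gap. *)
Lemma log_heat_adj x y (t s T : R) : adj x y -> 0 < t -> t < s -> s <= T ->
  log_heat x t <= log_heat y s + (wm / (mm * h) / (p * (1 + K * T)) * (s - t))^-1.
Proof.
move=> xy t0 ts sT; have m0 : 0 < mm := lt_le_trans (mu_gt0 x) (mu_le x).
have T0 : 0 < T := lt_le_trans t0 (le_trans (ltW ts) sT).
have pKT : 0 < p * (1 + K * T).
  by rewrite mulr_gt0// ltr_pwDl// mulr_ge0// ltW.
have pos (v : R) : t <= v <= s -> 0 < v by case/andP => tv _; exact: lt_le_trans tv.
apply: (riccati_le ts); first by rewrite divr_gt0// divr_gt0// mulr_gt0.
- by move=> v /pos v0; exact: is_derive_log_heat.
- by move=> v /pos v0; exact: is_derive_log_heat.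
- by move=> v /pos v0; exact: log_heat_derivative_ge0.
- by move=> v /pos v0; exact: log_heat_derivative_ge0.
move=> v tvs; have v0 := pos v tvs.
have u0 z : 0 < u v z by apply: (heat_gt0 D_gt0 deg_le eps_gt0 fM); exact: ltW.
rewrite /log_heat ltrD2r ltr_ln ?posrE// => uyx.
rewrite [X in X ^+ 2](_ : _ = ln (u v x) - ln (u v y)); last by ring.
have vT : v <= T by case/andP: tvs => _ vs; exact: le_trans sT.
apply: le_trans (log_derivative_ge y v0 vT).
rewrite mulrAC ler_pM2r ?invr_gt0//.
by apply: Gamma_psi_ge => //; rewrite adj_sym.
Qed.

Lemma log_heat_mono x (t s : R) : 0 < t -> t <= s -> log_heat x t <= log_heat x s.
Proof.
move=> t0 ts; apply: (@le_of_is_derive_ge0 R (log_heat x) _ t s ts).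
  by move=> v /andP[tv _]; apply: is_derive_log_heat; exact: lt_le_trans tv.
by move=> v /andP[tv _]; apply: log_heat_derivative_ge0; exact: lt_le_trans tv.
Qed.

Lemma log_heat_path x (q : seq G) (t tau T : R) : path adj x q -> 0 < t ->
  0 < tau -> t + (size q)%:R * tau <= T ->
  log_heat x t <= log_heat (last x q) (t + (size q)%:R * tau)
    + (size q)%:R / (wm / (mm * h) / (p * (1 + K * T)) * tau).
Proof.
move=> + + tau0; elim: q x t => [|y q ih] x t /=.
  by move=> _ t0 _; rewrite !mul0r !addr0.
move=> /andP[xy yq] t0; rewrite -[(size q).+1]addn1 natrD => tT.
have st : t + tau <= T.
  apply: le_trans tT; rewrite lerD2l mulrDl mul1r lerDr mulr_ge0//; exact: ltW.
have h1 := log_heat_adj xy t0 (ltr_pwDr tau0 (lexx t)) st.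
rewrite (_ : t + tau - t = tau) in h1; last by ring.
have h2 := ih y (t + tau) yq (addr_gt0 t0 tau0).
have e : t + tau + (size q)%:R * tau = t + ((size q)%:R + 1) * tau by ring.
rewrite e in h2; have {}h2 := h2 tT.
rewrite [(_ + 1) / _]mulrDl mul1r; lra.
Qed.

Lemma log_heat_harnack x y (t T : R) : 0 < t -> t < T ->
  log_heat x t <= log_heat y T + (graph_dist x y)%:R ^+ 2
    / (wm / (mm * h) / (p * (1 + K * T)) * (T - t)).
Proof.
move=> t0 tT; have [q [xq qy <-]] := graph_distP x y.
have [/size0nil q0|q0] := posnP (size q).
  rewrite q0 /= expr0n/= mul0r addr0 -qy q0.
  by apply: log_heat_mono => //; exact: ltW.
have qR : 0 < (size q)%:R :> R by rewrite ltr0n.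
(* The time is split equally among the edges of a shortest path. With [d] edges, each costs a
   multiple of [d / (T - t)], whence the square of the distance. *)
have tau0 : 0 < (T - t) / (size q)%:R by rewrite divr_gt0// subr_gt0.
have e : t + (size q)%:R * ((T - t) / (size q)%:R) = T.
  by field; rewrite gt_eqF.
have := log_heat_path (T := T) xq t0 tau0; rewrite e qy lexx => /(_ isT) /le_trans.
apply; rewrite lerD2l le_eqVlt; apply/orP; left; apply/eqP.
move: (wm / _ / _) => k; rewrite (invfM k (_ / _)) (invfM (T - t)) invrK.
by rewrite (invfM k (T - t)); move: k^-1 (T - t)^-1 => a b; ring.
Qed.

End Harnack.
End Solution.

(** * Heat remaining at the centre of a ball *)

Section BallSurvival.
Variables (c0 l0 sg : R).
Hypotheses (c0_gt0 : 0 < c0) (l0_gt0 : 0 < l0)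
  (eta_le : forall l : R, 0 < l -> l < l0 ->
    psi_bar psi (expR l) <= c0 * l ^+ 2 /\ psi_bar psi (expR (- l)) <= c0 * l ^+ 2)
  (sg_gt0 : 0 < sg) (sg_n : n * sg <= 2)
  (sg_p : (n * (D * c0) + 2) * sg <= p).

(** The cut-off at [N] keeps the function above a positive constant, as the estimates for solutions
    require. *)
Definition exp_dist (x : G) (lam : R) (N : nat) (y : G) : R :=
  expR (- (lam * (minn (graph_dist x y) N)%:R)).

Lemma exp_dist_bounds x (lam : R) N y : 0 <= lam ->
  expR (- (lam * N%:R)) <= exp_dist x lam N y <= 1.
Proof.
move=> lam0; apply/andP; split.
  by rewrite ler_expR lerN2 ler_wpM2l// ler_nat geq_minr.
by rewrite -[leRHS]expR0 ler_expR oppr_le0 mulr_ge0.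
Qed.

(** Values at adjacent vertices have ratio 1, [expR lam] or [expR (- lam)], which is where [eta_le]
    applies. *)
Lemma Gamma_psi_exp_dist x (lam : R) N y : 0 < lam -> lam < l0 ->
  Gamma_psi psi (exp_dist x lam N) y <= D * (c0 * lam ^+ 2).
Proof.
move=> lam0 laml; have [e1 e2] := eta_le lam0 laml.
have B0 : 0 <= c0 * lam ^+ 2 by rewrite mulr_ge0 ?sqr_ge0// ltW.
apply: Gamma_psi_le => // [|z yz]; first by rewrite gt_eqF// expR_gt0.
rewrite /exp_dist -expRN opprK -expRD.
have h1 := graph_dist_adj x yz.
have h2 : (graph_dist x y <= (graph_dist x z).+1)%N.
  by apply: graph_dist_adj; rewrite adj_sym.
have := minn_consecutive N h2 h1.
set a := minn _ _; set b := minn _ _ => -[] ab.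
- by rewrite ab addNr expR0 psi_bar1.
- by rewrite ab -[b.+1]addn1 natrD mulrDr mulr1 addrA addNr add0r.
- by rewrite ab -[a.+1]addn1 natrD mulrDr mulr1 opprD addrAC addNr add0r.
Qed.

(** In the variable [tau = sqrt t] the bound of order [1 / (r tau)] on the decay rate becomes a
    bounded slope: [ln u] loses at most [2 b / (p r)] per unit of [tau], starting from 0. *)
Lemma heat_exp_dist_ge x (r : R) N : 0 < r -> r^-1 < l0 ->
  expR (- 2^-1) <=
  heat D (exp_dist x r^-1 N) ((sg * r / (1 + K * r ^+ 2)) ^+ 2) x.
Proof.
move=> r0 rl; have ri0 : 0 < r^-1 by rewrite invr_gt0.
have n0 := n_gt0; have p0 := p_gt0; have sg0 := sg_gt0; have K0 := K_ge0.
set f := exp_dist x r^-1 N; pose S := D * (c0 * r^-1 ^+ 2).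
have eps0 : 0 < expR (- (r^-1 * N%:R)) :> R by exact: expR_gt0.
have fM y : expR (- (r^-1 * N%:R)) <= f y <= 1 by apply: exp_dist_bounds; exact: ltW.
have u0 (t : R) y : 0 <= t -> 0 < heat D f t y.
  exact: (heat_gt0 D_gt0 deg_le eps0 fM).
have Kr : 0 < 1 + K * r ^+ 2 by rewrite ltr_pwDl// mulr_ge0// sqr_ge0.
set tau0 := sg * r / _.
have tau0_gt0 : 0 < tau0 by rewrite divr_gt0// mulr_gt0.
pose b := (n * (D * c0) / 4 + 2^-1).
have b0 : 0 < b.
  by rewrite ltr_pwDr ?invr_gt0// divr_ge0// mulr_ge0// ?mulr_ge0// ltW.
pose w (tau : R) := ln (heat D f (tau ^+ 2) x) + 2 * b / (p * r) * tau ^+ 1.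
pose dw (tau : R) := laplacian (heat D f (tau ^+ 2)) x
  / heat D f (tau ^+ 2) x * (2 * tau) + 2 * b / (p * r).
have w_mono : w 0 <= w tau0.
  apply: (@le_of_is_derive_ge0 R w dw 0 tau0 (ltW tau0_gt0)).
    move=> tau _.
    have us0 := u0 (tau ^+ 2) x (sqr_ge0 tau).
    have d1 := is_derive_heat_initial D_gt0 deg_le eps0 fM (tau ^+ 2) x.
    have d2 := is_derive_monomial 1 tau 2.
    have dsq : is_derive tau (1 : R) (fun s => s ^+ 2) (2 * tau).
      rewrite (_ : (fun s => _) = fun s => 1 * s ^+ 2); last first.
        by apply/funext => s; rewrite mul1r.
      by apply: (is_derive_eq d2); rewrite /= expr1 mul1r.
    have d3 := is_derive_compf (is_derive_compf dsq d1) (is_derive1_ln us0).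
    apply: (is_derive_eq (is_derive_addf d3 (is_derive_monomial _ tau 1))).
    by rewrite /= expr0 !mulr1 mulrA [X in X * _]mulrC.
  move=> tau /andP[tau_ge0 tau_le]; rewrite /dw.
  have := tau_ge0; rewrite le_eqVlt => /predU1P[<-|tau_gt0].
    by rewrite !mulr0 add0r divr_ge0// mulr_ge0// ltW.
  (* The choice [gam = 1 / (r tau)] gives both terms of [laplacian_heat_ge] the order [1 / (r tau)].
     Its constraint holds up to [tau0] by [sg_n]. *)
  have gam0 : 0 < (r * tau)^-1 by rewrite invr_gt0 mulr_gt0.
  have Kgam : n * K <= 2 * (r * tau)^-1.
    rewrite ler_pdivlMr ?mulr_gt0//.
    apply: (@le_trans _ _ (n * K * (r * tau0))).
      by rewrite ler_wpM2l ?mulr_ge0 ?ler_pM2l// ltW.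
    rewrite /tau0 [leLHS](_ : _ = n * sg * (K * r ^+ 2) / (1 + K * r ^+ 2)); last first.
      by field; rewrite gt_eqF.
    rewrite ler_pdivrMr//; have Kr2 : 0 <= K * r ^+ 2 by rewrite mulr_ge0// sqr_ge0.
    apply: (@le_trans _ _ (2 * (K * r ^+ 2))); first by rewrite ler_wpM2r.
    by lra.
  have H : - (b / (r * tau)) <= p * laplacian (heat D f (tau ^+ 2)) x
      / heat D f (tau ^+ 2) x.
    have fS y : Gamma_psi psi f y <= S by exact: Gamma_psi_exp_dist.
    apply: le_trans (laplacian_heat_ge eps0 fM x fS gam0 Kgam (exprn_gt0 2 tau_gt0)).
    rewrite le_eqVlt; apply/orP; left; apply/eqP; rewrite /S /b; field.
    by rewrite !gt_eqF.
  have pr0 : 0 < p / (2 * tau) by rewrite divr_gt0// mulr_gt0.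
  rewrite -(pmulr_rge0 _ pr0).
  rewrite [leRHS](_ : _ = p * laplacian (heat D f (tau ^+ 2)) x
    / heat D f (tau ^+ 2) x + b / (r * tau)); first by lra.
  by field; rewrite !gt_eqF// u0// sqr_ge0.
have w0 : w 0 = 0.
  rewrite /w expr0n expr1 mulr0 addr0 heat0 /f /exp_dist graph_distxx min0n mulr0.
  by rewrite oppr0 expR0 ln1.
have ut := u0 (tau0 ^+ 2) x (sqr_ge0 tau0).
rewrite -[leRHS]lnK ?posrE// ler_expR.
(* By [sg_p] the total loss up to [tau0] is at most 1/2. *)
have : 2 * b / (p * r) * tau0 <= 2^-1.
  rewrite /tau0 [leLHS](_ : _ = 2 * b * sg / (p * (1 + K * r ^+ 2))); last first.
    by field; rewrite !gt_eqF.
  rewrite ler_pdivrMr ?mulr_gt0//; apply: (@le_trans _ _ (2^-1 * p)).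
    by rewrite /b; have := sg_p; lra.
  rewrite ler_pM2l ?invr_gt0// mulrDr mulr1 lerDl.
  by apply: mulr_ge0; [exact: ltW|rewrite mulr_ge0// sqr_ge0].
by move: w_mono; rewrite w0 /w expr1; lra.
Qed.

Definition ball_indicator (x : G) (r : R) (y : G) : R := (y \in graph_ball x r)%:R.

Lemma ball_indicator_bounds x r y : 0 <= ball_indicator x r y <= 1.
Proof. by rewrite /ball_indicator; case: (_ \in _); rewrite ?lexx ?ler01. Qed.

Lemma fun_bounded_ball_indicator x r : fun_bounded (ball_indicator x r).
Proof.
by exists 1 => y; rewrite ger0_norm; have /andP[] := ball_indicator_bounds x r y.
Qed.

(** If [r^-1 < l0], the indicator plus [expR (-1)] dominates [exp_dist]. Otherwise [eta_le] does not
    reach [r^-1], but the time is at most [(sg / l0)^2], and the zeroth term of the series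
    suffices. *)
Lemma heat_ball_indicator_ge x (r : R) : 0 < r ->
  Num.min (expR (- 2^-1) - expR (-1)) (expR (- (D * (sg / l0) ^+ 2))) <=
  heat D (ball_indicator x r) ((sg * r / (1 + K * r ^+ 2)) ^+ 2) x.
Proof.
move=> r0; set tau0 := sg * r / _; have tt0 : 0 <= tau0 ^+ 2 by exact: sqr_ge0.
have bB := fun_bounded_ball_indicator x r.
rewrite ge_min; have [rl|lr] := ltP r^-1 l0.
  (* As [r <= N], the cut-off distance is still at least [r] off the ball. *)
  apply/orP; left; set N := (Num.truncn r).+1.
  have rN : r <= N%:R by rewrite ltW// /N -Num.Theory.truncn_lt_nat// ltW.
  have bf : fun_bounded (exp_dist x r^-1 N).
    exists 1 => y; rewrite ger0_norm ?expR_ge0//.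
    by have /andP[] := exp_dist_bounds x N y (ltW (etrans (invr_gt0 r) r0)).
  have := heat_exp_dist_ge x N r0 rl; rewrite -/tau0 lerBlDr => /le_trans; apply.
  rewrite -[heat D (ball_indicator x r) _ x]mul1r.
  rewrite -[X in _ <= _ + X](heat_cst D (expR (-1)) (tau0 ^+ 2) x).
  rewrite -heat_lin//; last first.
    exact: fun_bounded_cst.
  apply: heat_le => //; first by apply: fun_bounded_lin => //; exact: fun_bounded_cst.
  move=> y; rewrite mul1r /ball_indicator; have [yB|yB] := boolP (y \in graph_ball x r).
    have /andP[_ /le_trans] := exp_dist_bounds x N y (ltW (etrans (invr_gt0 r) r0)).
    by apply; rewrite lerDl expR_ge0.
  rewrite add0r /exp_dist ler_expR lerN2 mulrC ler_pdivlMr// mul1r.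
  rewrite /minn; case: ifP => // _.
  by move: yB; rewrite notin_setE /= => /negP; rewrite -leNgt.
apply/orP; right.
have f0 y : 0 <= ball_indicator x r y by have /andP[] := ball_indicator_bounds x r y.
have := heat_ge_exp D_gt0 deg_le x bB f0 tt0.
apply: le_trans; rewrite /ball_indicator mem_set; last first.
  by rewrite /graph_ball/= graph_distxx.
have K0 := K_ge0; have sg0 := sg_gt0; have n0 := n_gt0.
have Kr : 1 <= 1 + K * r ^+ 2 by rewrite lerDl mulr_ge0// sqr_ge0.
have tau_le : tau0 <= sg / l0.
  rewrite /tau0 -mulrA ler_pM2l// ler_pdivrMr; last exact: lt_le_trans Kr.
  apply: (@le_trans _ _ l0^-1); first
    by rewrite -[leLHS]invrK lef_pV2 ?posrE// invr_gt0.
  by rewrite -[leLHS]mulr1 ler_pM2l ?invr_gt0.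
have tau0_ge0 : 0 <= tau0.
  by rewrite divr_ge0// ?mulr_ge0// ?ltW// (lt_le_trans _ Kr).
rewrite mulr1 ler_expR lerN2 ler_pM2l//; apply: lerXn2r => //.
by rewrite nnegrE (le_trans tau0_ge0).
Qed.

Lemma mass_le_ball_indicator x (r : R) : finite_set (graph_ball x r) ->
  mass_le (ball_indicator x r) (volume x r).
Proof.
move=> finB F uF; rewrite /volume fsbig_finite//.
rewrite [leLHS](bigID (fun y => y \in graph_ball x r))/=.
rewrite [X in _ + X]big1 ?addr0; last first.
  by move=> y /negbTE yB; rewrite /ball_indicator yB mulr0.
rewrite [leLHS](eq_bigr mu); last first.
  by move=> y yB; rewrite /ball_indicator yB mulr1.
rewrite [leRHS](bigID (fun y => y \in F))/= -[leLHS]addr0; apply: lerD; last first.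
  by apply: sumr_ge0 => y _; exact/ltW/mu_gt0.
rewrite -[leLHS]big_filter -[leRHS]big_filter le_eqVlt; apply/orP; left; apply/eqP.
apply: perm_big; apply: uniq_perm.
- exact: filter_uniq.
- exact/filter_uniq/finmap.fset_uniq.
move=> y; rewrite !mem_filter andbC; congr (_ && _).
by rewrite in_fset_set.
Qed.

(** * Volume doubling *)

Section Doubling.
Variables (mm wm h : R).
Hypotheses (mu_le : forall x : G, mu x <= mm) (wm_gt0 : 0 < wm)
  (wm_le : forall x y : G, adj x y -> wm <= weight x y)
  (h_gt0 : 0 < h) (sg_le1 : sg <= 1)
  (ln2_le : forall s : R, 1 < s -> ln s ^+ 2 <= h * psi_bar psi s).

(** [E0] and [E1] collect the Harnack loss. With [b = n / (2 p)], [q = p / (wm / (mm h))] and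
    [Z = K r^2], the term [b ln (T / t)] costs [b ln (1 + sg^-2) + 2 b Z], the term [b K (T - t)]
    costs [b Z], and the distance costs [4 q + 8 q Z]. *)
Lemma volume_doubling (x : G) (r c1 E0 E1 : R) : 0 < r ->
  c1 = Num.min (expR (- 2^-1) - expR (-1)) (expR (- (D * (sg / l0) ^+ 2))) ->
  E0 = n / (2 * p) * ln (1 + sg ^- 2) + 4 * (p / (wm / (mm * h))) ->
  E1 = 3 * (n / (2 * p)) + 8 * (p / (wm / (mm * h))) ->
  c1 * volume x (2 * r) <= expR (E0 + E1 * (K * r ^+ 2)) * volume x r.
Proof.
move=> r0 c1E E0E E1E.
(* [volume] takes the junk value 0 on an infinite ball, so that finiteness of
   balls need not be proved. *)
have [finB2|infB2] := pselect (finite_set (graph_ball x (2 * r))); last first.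
  rewrite [volume x (2 * r)](_ : _ = 0).
    by rewrite mulr0 mulr_ge0 ?expR_ge0// /volume fsumr_ge0// => y _; exact/ltW/mu_gt0.
  rewrite /volume no_finite_support ?big_nil//.
  rewrite (_ : _ `&` _ = graph_ball x (2 * r))//.
  by apply/seteqP; split=> [y []//|y yB]; split=> //=; apply/eqP;
    rewrite gt_eqF// mu_gt0.
have finB : finite_set (graph_ball x r).
  apply: sub_finite_set finB2 => y /= /lt_le_trans; apply.
  by move: r0; lra.
have K0 := K_ge0; have sg0 := sg_gt0; have n0 := n_gt0; have p0 := p_gt0.
have m0 : 0 < mm := lt_le_trans (mu_gt0 x) (mu_le x).
have r2 : 0 < r ^+ 2 by rewrite exprn_gt0.
have Kr2 : 0 <= K * r ^+ 2 by rewrite mulr_ge0// ltW.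
have Kr : 0 < 1 + K * r ^+ 2 by lra.
set tau0 := sg * r / (1 + K * r ^+ 2).
have tau0_gt0 : 0 < tau0 by rewrite divr_gt0// mulr_gt0.
(* At time [t] the heat at the centre is bounded below; the further time [r^2] pays for distances up
   to [2 r]. *)
pose t := tau0 ^+ 2; pose T := t + r ^+ 2.
have t0 : 0 < t by rewrite exprn_gt0.
have tT : t < T by rewrite ltrDl.
have T0 : 0 < T := lt_trans t0 tT.
pose f := ball_indicator x r; have bf := fun_bounded_ball_indicator x r.
have f0 y : 0 <= f y by have /andP[] := ball_indicator_bounds x r y.
have f1 y : f y <= 1 by have /andP[] := ball_indicator_bounds x r y.
set E := E0 + E1 * (K * r ^+ 2).
have tau_le : tau0 <= r.
  rewrite /tau0 ler_pdivrMr//; apply: (@le_trans _ _ (1 * r)).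
    by rewrite ler_pM2r.
  by rewrite mul1r mulrDr mulr1 lerDl mulr_ge0// ltW.
have T_le : T <= 2 * r ^+ 2.
  by rewrite /T mulr2n mulrDl mul1r lerD2r /t; apply: lerXn2r; rewrite ?nnegrE// ltW.
(* Here [T / t = 1 + sg^-2 (1 + K r^2)^2], and [1 + K r^2 <= exp (K r^2)] makes the logarithm linear
   in [K r^2]. *)
have lnT : ln T - ln t <= ln (1 + sg ^- 2) + 2 * (K * r ^+ 2).
  rewrite -ln_div ?posrE//.
  have sg2 : 0 < 1 + sg ^- 2 by rewrite ltr_pwDl// invr_ge0 sqr_ge0.
  have -> : 2 * (K * r ^+ 2) = ln (expR (K * r ^+ 2) ^+ 2).
    by rewrite -expRM_natl expRK.
  have eK0 : 0 < expR (K * r ^+ 2) ^+ 2 :> R by rewrite exprn_gt0// expR_gt0.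
  have Tt : 0 < T / t by rewrite divr_gt0.
  rewrite -lnM ?posrE// ler_ln ?posrE//; last exact: mulr_gt0.
  have eK : 1 + K * r ^+ 2 <= expR (K * r ^+ 2) by exact: expR_ge1Dx.
  apply: (@le_trans _ _ ((1 + sg ^- 2) * (1 + K * r ^+ 2) ^+ 2)); last first.
    by rewrite ler_pM2l//; apply: lerXn2r; rewrite ?nnegrE ?expR_ge0// ltW.
  rewrite [leLHS](_ : _ = 1 + sg ^- 2 * (1 + K * r ^+ 2) ^+ 2); last first.
    by rewrite /T /t /tau0; field; rewrite !gt_eqF.
  by rewrite mulrDl mul1r lerD2r exprn_ege1// lerDl.
(* The indicator can vanish, so [eps] is added to reach the estimates for positive solutions. The
   semigroup fixes constants, and [eps] is made arbitrarily small in [lower]. *)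
have harnack y (eps : R) : graph_ball x (2 * r) y -> 0 < eps ->
    heat D f t x + eps <= expR E * (heat D f T y + eps).
  move=> yB eps0.
  pose feps z := 1 * f z + eps.
  have fepsM z : eps <= feps z <= 1 + eps.
    by rewrite /feps mul1r lerDr f0/= lerD2r f1.
  have hE s z : heat D feps s z = heat D f s z + eps.
    rewrite /feps (heat_lin D_gt0 deg_le)//; last exact: fun_bounded_cst.
    by rewrite heat_cst mul1r.
  have u0 (s : R) z : 0 <= s -> 0 < heat D feps s z.
    exact: (heat_gt0 D_gt0 deg_le eps0 fepsM).
  have := log_heat_harnack eps0 fepsM mu_le wm_gt0 wm_le h_gt0 ln2_le x y t0 tT.
  rewrite /log_heat -!hE; set k := wm / (mm * h) => H.
  have k0 : 0 < k by rewrite divr_gt0// mulr_gt0.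
  have ut := u0 t x (ltW t0); have uT := u0 T y (ltW T0).
  have dist_le : (graph_dist x y)%:R ^+ 2 / (k / (p * (1 + K * T)) * (T - t))
      <= 4 * (p / k) + 8 * (p / k) * (K * r ^+ 2).
    rewrite (_ : T - t = r ^+ 2); last by rewrite /T addrAC subrr add0r.
    have KT : 0 < 1 + K * T by rewrite ltr_pwDl// mulr_ge0// ltW.
    rewrite ler_pdivrMr; last by rewrite mulr_gt0// divr_gt0// mulr_gt0.
    apply: (@le_trans _ _ ((2 * r) ^+ 2)).
      by apply: lerXn2r; rewrite ?nnegrE ?ler0n//;
        [rewrite mulr_ge0// ltW|exact: ltW yB].
    have KT2 : K * T <= 2 * (K * r ^+ 2) by rewrite mulrCA ler_wpM2l.
    rewrite [leRHS](_ : _ = (2 * r) ^+ 2 * ((1 + 2 * (K * r ^+ 2))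
        / (1 + K * T))); last first.
      by field; rewrite !gt_eqF.
    rewrite ler_peMr ?sqr_ge0// ler_pdivlMr// mul1r; lra.
  have b0 : 0 < n / (2 * p) by rewrite divr_gt0// mulr_gt0.
  have lnTb : n / (2 * p) * (ln T - ln t) <=
      n / (2 * p) * (ln (1 + sg ^- 2) + 2 * (K * r ^+ 2)).
    by rewrite ler_pM2l.
  have KTt : K * T = K * t + K * r ^+ 2 by rewrite /T mulrDr.
  rewrite -[leLHS]lnK ?posrE// -[heat D feps T y]lnK ?posrE// -expRD ler_expR.
  rewrite KTt in H dist_le; rewrite /E E0E E1E -/k; move: H lnTb dist_le.
  set b := n / _; set L := ln (1 + _); set Z := K * r ^+ 2; set q := p / k.
  set d2 := _ / _; set l1 := ln T; set l2 := ln t; set l3 := ln _; set l4 := ln _.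
  move=> H lnTb dist_le.
  have {}H : l3 <= l4 + b * (l1 - l2) + b * Z + d2 by lra.
  lra.
have lower y : graph_ball x (2 * r) y -> c1 <= expR E * heat D f T y.
  move=> yB; apply: (@le_trans _ _ (heat D f t x)).
    rewrite c1E; exact: heat_ball_indicator_ge.
  apply/ler_addgt0Pr => e e0; have e'0 : 0 < e / expR E by rewrite divr_gt0// expR_gt0.
  have := harnack y (e / expR E) yB e'0.
  rewrite mulrDr [expR E * (e / _)]mulrCA mulfV ?mulr1 ?gt_eqF ?expR_gt0//.
  by apply: le_trans; rewrite lerDl ltW.
(* The heat at time [T] has mass at most [volume x r]; summing [lower] over the larger ball against
   [mu] compares this with [volume x (2 * r)]. *)
have mass := heat_mass_le D_gt0 deg_le bf f0 (ltW T0) (mass_le_ball_indicator finB).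
pose B2 : seq G := finmap.enum_fset (fset_set (graph_ball x (2 * r))).
have massE : expR E * (\sum_(y <- B2) mu y * heat D f T y) <= expR E * volume x r.
  by rewrite ler_pM2l ?expR_gt0//; apply: mass; exact: finmap.fset_uniq.
apply: le_trans massE; rewrite {1}/volume fsbig_finite// -/B2 !mulr_sumr.
rewrite big_seq [leRHS]big_seq; apply: ler_sum => y.
rewrite in_fset_set// inE => yB.
by rewrite mulrC mulrCA ler_pM2l ?mu_gt0//; exact: lower.
Qed.

End Doubling.
End BallSurvival.
End LiYau.

(** * Choice of the constants *)

Theorem theorem1p2 (R : realType) (n : R) (psi : R -> R) (Dmu mumax wmin : \bar R)
    (n_gt0 : 0 < n) (psi_C1 : C1_pos psi) (psi_concave : concave_pos psi)
    (dpsi1_gt0 : 0 < derive1 psi 1) (H_lty : (H_psi psi < +oo)%E)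
    (eta_lty :
      (limf_esup (fun l : R => (eta_psi psi l / l ^+ 2)%:E) 0^'+ < +oo)%E)
    (Dmu_lty : (Dmu < +oo)%E) (mumax_lty : (mumax < +oo)%E)
    (wmin_gt0 : (0 < wmin)%E) :
  exists c C : R, [/\ 0 < c, 0 < C &
    forall (G : weighted_graph R) (K : R),
      D_mu G = Dmu -> mu_max G = mumax -> w_min G = wmin ->
      0 <= K -> CDpsi G psi n (- K) ->
      forall (x : G) (r : R), 0 < r ->
        volume x (2 * r) <= C * expR (c * K * r ^+ 2) * volume x r].
Proof.
have [h h_gt0 ln2_le] := H_psi_bound psi_C1 psi_concave H_lty.
have [c0 [l0 [c0_gt0 l0_gt0 eta_le]]] := eta_psi_bound eta_lty.
(* The bound is taken positive because [D] is divided by, while [D_mu] can be 0 on a one-vertex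
   graph. *)
have finite_bound (e : \bar R) : (e < +oo)%E -> exists2 d : R, 0 < d & (e <= d%:E)%E.
  case: e => [d| |]// _.
    by exists (Num.max 1 d); rewrite ?lt_max ?ltr01// lee_fin le_max lexx orbT.
  by exists 1 => //; exact: leNye.
have [D D_gt0 Dmu_le] := finite_bound _ Dmu_lty.
have [mm mm_gt0 mumax_le] := finite_bound _ mumax_lty.
(* If there is no edge, [wmin] is [+oo] and 1 serves as a lower bound. *)
have [wm wm_gt0 wm_le] : exists2 w : R, 0 < w & (w%:E <= wmin)%E.
  case: wmin wmin_gt0 => [w| |]//; rewrite ?lte_fin => w0; first by exists w.
  by exists 1 => //; exact: leey.
set p := derive1 psi 1.
have nDc : 0 < n * (D * c0) + 2 by rewrite ltr_pwDr// !mulr_ge0// ltW.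
(* The three entries are what [sg_le1], [sg_n] and [sg_p] ask for; neither [G] nor [K] enters. *)
pose sg := Num.min 1 (Num.min (2 / n) (p / (n * (D * c0) + 2))).
have sg_gt0 : 0 < sg by rewrite !lt_min ltr01 !divr_gt0.
have sg_le1 : sg <= 1 by rewrite ge_min lexx.
have sg_n : n * sg <= 2 by rewrite mulrC -ler_pdivlMr// !ge_min lexx orbT.
have sg_p : (n * (D * c0) + 2) * sg <= p.
  by rewrite mulrC -ler_pdivlMr// !ge_min lexx !orbT.
pose c1 := Num.min (expR (- 2^-1) - expR (-1)) (expR (- (D * (sg / l0) ^+ 2))) : R.
pose E0 := n / (2 * p) * ln (1 + sg ^- 2) + 4 * (p / (wm / (mm * h))).
pose E1 := 3 * (n / (2 * p)) + 8 * (p / (wm / (mm * h))).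
have c1_gt0 : 0 < c1.
  by rewrite lt_min expR_gt0 andbT subr_gt0 ltr_expR; lra.
have E1_gt0 : 0 < E1.
  have b0 : 0 < n / (2 * p) by rewrite divr_gt0// mulr_gt0.
  have q0 : 0 < p / (wm / (mm * h)) by rewrite divr_gt0// divr_gt0// mulr_gt0.
  by rewrite /E1; lra.
exists E1, (expR E0 / c1); split=> //; first by rewrite divr_gt0// expR_gt0.
move=> G K GD Gm Gw K_ge0 cd x r r_gt0.
have deg_le (y : G) : deg y <= D * mu y.
  rewrite -ler_pdivrMr ?mu_gt0// -lee_fin; apply: le_trans Dmu_le; rewrite -GD.
  by apply: ereal_sup_ubound; exists y.
have mu_le (y : G) : mu y <= mm.
  rewrite -lee_fin; apply: le_trans mumax_le; rewrite -Gm.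
  by apply: ereal_sup_ubound; exists y.
have weight_ge (y z : G) : adj y z -> wm <= weight y z.
  move=> yz; rewrite -lee_fin; apply: le_trans wm_le _; rewrite -Gw.
  by apply: ereal_inf_lbound; exists (y, z).
have := volume_doubling D_gt0 deg_le psi_C1 psi_concave n_gt0 K_ge0 cd dpsi1_gt0
  c0_gt0 l0_gt0 eta_le sg_gt0 sg_n sg_p mu_le wm_gt0 weight_ge h_gt0 sg_le1 ln2_le
  x r_gt0 (erefl c1) (erefl E0) (erefl E1).
rewrite -ler_pdivlMl// => /le_trans; apply.
by rewrite expRD le_eqVlt; apply/orP; left; apply/eqP; rewrite -[E1 * K * _]mulrA; ring.
Qed.
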